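(* Let $\{\alpha_1,\dots,\alpha_n\}$ be an orthonormal set in $L_2[0,T]$, let $p_1,\dots,p_n$ be nonnegative integers, let $F(x)=\prod_{j=1}^n \langle \alpha_j,x\rangle^{2p_j}$ for $x\in C_0[0,T]$, and let $q$ be a nonzero real number. Then the $L_1$ analytic Fourier–Feynman transform $T_q^{(1)}(F)$ of $F$ exists and, for s-a.e. $y\in C_0[0,T]$, $$T_q^{(1)}(F)(y)=\prod_{j=1}^n \Bigl[ \sum_{s=0}^{p_j} {}_{2p_j} C_{2s}\, (2s-1)!!\,\Bigl(\frac{i}{q}\Bigr)^s \langle \alpha_j,y \rangle^{2p_j-2s} \Bigr].$$
   Context: $C_0[0,T]$ ($T>0$) is the space of real-valued continuous functions $x$ on $[0,T]$ with $x(0)=0$, with Wiener measure $m$ on the $\sigma$-algebra $\mathcal M$ of Wiener measurable sets. For $v\in L_2[0,T]$, $\langle v,x\rangle$ is the Paley–Wiener–Zygmund stochastic integral (Gaussian with mean $0$, variance $\|v\|_2^2$, linear in $x$). A set $B$ is scale-invariant measurable if $\rho B\in\mathcal M$ for all $\rho>0$, scale-invariant null if moreover $m(\rho B)=0$ for all $\rho>0$; ''s-a.e.'' means outside a scale-invariant null set. $\mathbb C_+=\{\lambda\in\mathbb C:\mathrm{Re}\,\lambda>0\}$, and $\lambda^{1/2}$ is the principal square root. For a functional $G$ on $C_0[0,T]$ such that $J(\lambda)=\int_{C_0[0,T]}G(\lambda^{-1/2}x)\,m(dx)$ exists for all $\lambda>0$, if there is a function $J^*$ analytic on $\mathbb C_+$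 with $J^*=J$ on $(0,\infty)$, then $J^*(\lambda)$ is the analytic Wiener integral $\int^{\mathrm{anw}_\lambda}G(x)\,m(dx)$. For $\lambda\in\mathbb C_+$ and $y\in C_0[0,T]$, $T_\lambda(F)(y)=\int^{\mathrm{anw}_\lambda}_{C_0[0,T]}F(y+x)\,m(dx)$, and the $L_1$ analytic Fourier–Feynman transform is $T_q^{(1)}(F)(y)=\lim_{\lambda\to -iq,\ \lambda\in\mathbb C_+}T_\lambda(F)(y)$ for s-a.e. $y$. ${}_nC_k=\frac{n!}{k!(n-k)!}$; $(2s-1)!!=(2s-1)(2s-3)\cdots3\cdot1$ for $s\ge1$, $(-1)!!=1$. *)

(* Defs.v *)
From HB Require Import structures.
From mathcomp Require Import all_boot all_order all_algebra.
From mathcomp Require Import all_classical all_reals all_analysis.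
From mathcomp Require Import complex.
Set Implicit Arguments.
Unset Strict Implicit.
Unset Printing Implicit Defensive.
Import Order.TTheory GRing.Theory Num.Theory.
Import numFieldTopology.Exports numFieldNormedType.Exports.
Local Open Scope ring_scope.
Local Open Scope classical_set_scope.

Section WienerDefs.
Context {R : realType}.

Definition Cx : numFieldType := (R[i] : numFieldType).
Definition RtoC (x : R) : Cx := Complex x 0.
Definition iC : Cx := Complex 0 1.

(** [C0 T x] : x represents an element of C_0[0,T].  A path on [0,T] is
    represented by the function R -> R which is continuous, vanishes on
    (-oo,0] and is constant (= x T) on [T,+oo); this is a bijective
    encoding of C_0[0,T]. *)
Definition C0 (T : R) (x : R -> R) : Prop :=
  continuous x /\ (forall t, t <= 0 -> x t = 0) /\ (forall t, T <= t -> x t = x T).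

Definition L2ip (T : R) (u v : R -> R) : R :=
  \int[lebesgue_measure]_(t in `[0, T]) (u t * v t).

Definition inL2 (T : R) (u : R -> R) : Prop :=
  measurable_fun `[0, T] u /\
  lebesgue_measure.-integrable `[0, T] (fun t => ((u t) ^+ 2)%:E).

Definition L2orthonormal (T : R) (n : nat) (alpha : 'I_n -> R -> R) : Prop :=
  (forall j, inL2 T (alpha j)) /\
  (forall i j, L2ip T (alpha i) (alpha j) = (i == j)%:R).

(** A fixed complete orthonormal set of L_2[0,T] consisting of functions of
    bounded variation (the cosine basis). *)
Definition cons_basis (T : R) (k : nat) (t : R) : R :=
  if k == 0%N then (Num.sqrt T)^-1
  else Num.sqrt (2 / T) * cos (k%:R * pi * t / T).

Definition RS_sum (T : R) (phi x : R -> R) (N : nat) : R :=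
  \sum_(i < N) phi (i%:R * T / N%:R) *
               (x (i.+1%:R * T / N%:R) - x (i%:R * T / N%:R)).
Definition RS_int (T : R) (phi x : R -> R) : R := limn (RS_sum T phi x).

Definition PWZ_partial (T : R) (v x : R -> R) (N : nat) : R :=
  \sum_(k < N) L2ip T v (cons_basis T k) * RS_int T (cons_basis T k) x.
Definition PWZ (T : R) (v x : R -> R) : R :=
  if pselect (cvgn (PWZ_partial T v x)) then limn (PWZ_partial T v x) else 0.

(** Wiener measure: [X] is a (coordinate) map from the probability space
    (Omega, P) to C_0[0,T] whose law is Wiener measure, i.e. the
    increments over any partition 0 = t_0 < ... < t_k <= T are independent
    centered Gaussians with variances t_{i+1} - t_i. *)
Definition is_wiener {d : measure_display} {Omega : measurableType d}
    (T : R) (P : probability Omega R) (X : Omega -> R -> R) : Prop :=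
  [/\ (forall w, C0 T (X w)),
      (forall t, measurable_fun setT (fun w => X w t)) &
      (forall (k : nat) (t : nat -> R) (B : nat -> set R),
          t 0%N = 0 -> (forall i, (i < k)%N -> t i < t i.+1) -> t k <= T ->
          (forall i, measurable (B i)) ->
          P [set w | forall i, (i < k)%N -> B i (X w (t i.+1) - X w (t i))]
          = (\prod_(i < k) normal_prob 0 (Num.sqrt (t i.+1 - t i)) (B i))%E)].

Section WithMeasure.
Context {d : measure_display} {Omega : measurableType d}
        (P : probability Omega R) (X : Omega -> R -> R).

(** Wiener null set (null for the completed Wiener measure). *)
Definition wiener_null (B : set (R -> R)) : Prop :=
  exists A, measurable A /\ P A = 0%E /\ [set w | B (X w)] `<=` A.

Definition si_null (B : set (R -> R)) : Prop :=
  forall rho : R, 0 < rho -> wiener_null [set (fun t => rho * x t) | x in B].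

Definition wint_exists (G : (R -> R) -> Cx) : Prop :=
  P.-integrable setT (fun w => (complex.Re (G (X w)))%:E) /\
  P.-integrable setT (fun w => (complex.Im (G (X w)))%:E).
Definition wint (G : (R -> R) -> Cx) : Cx :=
  RtoC (\int[P]_(w in setT) complex.Re (G (X w)))
  + iC * RtoC (\int[P]_(w in setT) complex.Im (G (X w))).

Definition Cplus : set Cx := [set z | 0 < complex.Re z].

Definition analytic_on_Cplus (J : Cx -> Cx) : Prop :=
  forall z, Cplus z -> exists D : Cx, (fun h => (J (z + h) - J z) / h) @ 0^' --> D.

Definition scale_path (lam : R) (x : R -> R) : R -> R :=
  fun t => (Num.sqrt lam)^-1 * x t.

(** [T_lambda(F)(y)] exists for every lambda in C_+ (given by the analytic
    extension J of the Wiener integrals lambda |-> int F(y + lambda^{-1/2} x) m(dx),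
    lambda > 0), and T_q^{(1)}(F)(y) = lim_{lambda -> -iq, lambda in C_+} J(lambda)
    equals L. *)
Definition FFT1_at (F : (R -> R) -> Cx) (q : R) (y : R -> R) (L : Cx) : Prop :=
  (forall lam : R, 0 < lam ->
     wint_exists (fun x => F (fun t => y t + scale_path lam x t))) /\
  exists J : Cx -> Cx,
    [/\ analytic_on_Cplus J,
        (forall lam : R, 0 < lam ->
           J (RtoC lam) = wint (fun x => F (fun t => y t + scale_path lam x t))) &
        J z @[z --> within Cplus (nbhs (- iC * RtoC q))] --> L].

Definition FFT1_sae (T : R) (F : (R -> R) -> Cx) (q : R) (G : (R -> R) -> Cx) : Prop :=
  exists N : set (R -> R), si_null N /\
    forall y, C0 T y -> ~ N y -> FFT1_at F q y (G y).

End WithMeasure.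

(** Odd double factorial (2s-1)!! = 1 * 3 * ... * (2s-1), with (-1)!! = 1. *)
Definition odd_dfact (s : nat) : nat := \prod_(i < s) (2 * i + 1).

End WienerDefs.

(* Main.v *)
(** The Paley-Wiener-Zygmund integrals of an orthonormal family are jointly
    standard Gaussian in the sense of moments: every linear combination
    [sum_j t_j <alpha_j, X>] has the moments of a centered Gaussian of variance
    [sum_j t_j^2], and the mixed moments are the coefficients of these
    polynomials in the [t_j].  For Riemann-Stieltjes sums this is independence
    of the increments; it passes to the limit because almost sure convergence
    with bounded second moments implies convergence of expectations.  The limit
    variance is given by Parseval's identity, i.e. by completeness of the cosine
    system, and the series defining [<alpha, X>] converges almost surely by a
    fourth-moment maximal inequality.  Finally
    [E prod_j (a_j + l^(-1/2) <alpha_j, X>)^(2 p_j)] is a polynomial in [1/l],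
    which is its own analytic continuation. *)

Require Import Defs.
From HB Require Import structures.
From mathcomp Require Import all_boot all_order all_algebra.
From mathcomp Require Import all_classical all_reals all_analysis.
From mathcomp Require Import complex.
From mathcomp Require Import measurable_realfun.
From mathcomp Require Import ring lra zify.
Set Implicit Arguments.
Unset Strict Implicit.
Unset Printing Implicit Defensive.
Import Order.TTheory GRing.Theory Num.Theory.
Import numFieldTopology.Exports numFieldNormedType.Exports.
Local Open Scope ring_scope.
Local Open Scope classical_set_scope.

(** * Gaussian moments *)

Section OddDoubleFactorial.

Lemma odd_dfact0 : odd_dfact 0 = 1%N.
Proof. by rewrite /odd_dfact big_ord0. Qed.

Lemma odd_dfactS s : odd_dfact s.+1 = ((2 * s).+1 * odd_dfact s)%N.
Proof. by rewrite /odd_dfact big_ord_recr/= addn1 mulnC. Qed.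

Lemma odd_dfact_fact s : ((2 * s)`! = 2 ^ s * s`! * odd_dfact s)%N.
Proof.
elim: s => [|s IH]; first by rewrite muln0 odd_dfact0.
by rewrite mulnS add2n !factS IH odd_dfactS expnS; ring.
Qed.

Lemma bin_odd_dfact s k : (k <= s)%N ->
  ('C(2 * s, 2 * k) * (odd_dfact k * odd_dfact (s - k)) =
   odd_dfact s * 'C(s, k))%N.
Proof.
move=> ks; have k2s : (2 * k <= 2 * s)%N by rewrite leq_mul2l.
have := bin_fact k2s; rewrite -mulnBr !odd_dfact_fact -(bin_fact ks).
have -> : (2 ^ s = 2 ^ k * 2 ^ (s - k))%N by rewrite -expnD subnKC.
set c := (2 ^ k * 2 ^ (s - k) * (k`! * (s - k)`!))%N => e.
have c0 : (0 < c)%N by rewrite !muln_gt0 !expn_gt0 !fact_gt0.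
apply/eqP; rewrite -(eqn_pmul2l c0); apply/eqP.
transitivity ('C(2 * s, 2 * k) * (2 ^ k * k`! * odd_dfact k *
  (2 ^ (s - k) * (s - k)`! * odd_dfact (s - k))))%N; first by rewrite /c; ring.
by rewrite e /c; ring.
Qed.

End OddDoubleFactorial.

Lemma sum_odd_vanish (V : nmodType) (f : nat -> V) n :
  (forall k, odd k -> f k = 0) ->
  \sum_(k < (2 * n).+1) f k = \sum_(s < n.+1) f (2 * s)%N.
Proof.
move=> f0; elim: n => [|n IH]; first by rewrite !big_ord_recl !big_ord0.
rewrite mulnS add2n big_ord_recr/= big_ord_recr/= IH f0 ?addr0; last first.
  by rewrite /= mul2n odd_double.
by rewrite [RHS]big_ord_recr/= mulnS add2n.
Qed.

Section GaussMoment.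
Context {R : realType}.
Implicit Types v w : R.

Definition gauss_moment v m : R :=
  if odd m then 0 else (odd_dfact m./2)%:R * v ^+ m./2.

Lemma gauss_moment_odd v m : odd m -> gauss_moment v m = 0.
Proof. by rewrite /gauss_moment => ->. Qed.

Lemma gauss_moment_even v s :
  gauss_moment v (2 * s) = (odd_dfact s)%:R * v ^+ s.
Proof. by rewrite /gauss_moment mul2n odd_double doubleK. Qed.

Lemma gauss_moment0 v : gauss_moment v 0 = 1.
Proof. by rewrite -(muln0 2) gauss_moment_even odd_dfact0 mul1r. Qed.

Lemma gauss_momentSS v m : gauss_moment v m.+2 = m.+1%:R * v * gauss_moment v m.
Proof.
have [om|em] := boolP (odd m).
  by rewrite !gauss_moment_odd ?mulr0//= negbK.
have -> : m = (2 * m./2)%N by rewrite mul2n halfK (negbTE em) subn0.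
by rewrite -add2n -mulnS !gauss_moment_even odd_dfactS natrM exprS; ring.
Qed.

Lemma gauss_moment_var0 m : gauss_moment 0 m = 0 ^+ m.
Proof.
case: m => [|[|m]]; first by rewrite gauss_moment0 expr0.
  by rewrite gauss_moment_odd// expr1.
by rewrite gauss_momentSS mulr0 mul0r expr0n.
Qed.

Lemma gauss_momentZ b v k :
  gauss_moment (b ^+ 2 * v) k = b ^+ k * gauss_moment v k.
Proof.
have [ok|ek] := boolP (odd k); first by rewrite !gauss_moment_odd ?mulr0.
have -> : k = (2 * k./2)%N by rewrite mul2n halfK (negbTE ek) subn0.
by rewrite !gauss_moment_even exprMn -exprM mulrCA.
Qed.

Lemma gauss_momentD v w m :
  \sum_(k < m.+1) 'C(m, k)%:R * (gauss_moment v k * gauss_moment w (m - k)) =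
  gauss_moment (v + w) m.
Proof.
have [om|em] := boolP (odd m).
  rewrite gauss_moment_odd// big1// => k _; have [ok|ek] := boolP (odd k).
    by rewrite gauss_moment_odd// mul0r mulr0.
  rewrite (gauss_moment_odd w) ?mulr0//.
  by rewrite oddB ?om ?(negbTE ek)// -ltnS.
have -> : m = (2 * m./2)%N by rewrite mul2n halfK (negbTE em) subn0.
set s := m./2.
rewrite (sum_odd_vanish (f := fun k => 'C(2 * s, k)%:R *
  (gauss_moment v k * gauss_moment w (2 * s - k)))); last first.
  by move=> k ok; rewrite gauss_moment_odd// mul0r mulr0.
rewrite gauss_moment_even addrC exprDn mulr_sumr; apply: eq_bigr => k _.
rewrite -mulnBr !gauss_moment_even.
have /(congr1 (fun i => i%:R : R)) := @bin_odd_dfact s k (ltn_ord k).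
rewrite !natrM => e.
rewrite -[in RHS]mulr_natl.
transitivity ('C(2 * s, 2 * k)%:R *
  ((odd_dfact k)%:R * (odd_dfact (s - k))%:R) * (v ^+ k * w ^+ (s - k))).
  by ring.
by rewrite e; ring.
Qed.

Lemma gauss_moment_continuous m : continuous (fun v : R => gauss_moment v m).
Proof.
move=> v; rewrite /gauss_moment; case: (odd m); first exact: cvg_cst.
by apply: cvgM; [exact: cvg_cst|exact: exprn_continuous].
Qed.

End GaussMoment.

(** * Integrals of real-valued functions *)

Section RealIntegrals.
Context d (T : measurableType d) (R : realType).
Variables (mu : {measure set T -> \bar R}) (D : set T) (mD : measurable D).
Implicit Types f g h : T -> R.

Lemma EFin_Rintegral f : mu.-integrable D (EFin \o f) ->
  (\int[mu]_(x in D) f x)%:E = (\int[mu]_(x in D) (f x)%:E)%E.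
Proof. by move=> fi; rewrite /Rintegral fineK//; exact: integrable_fin_num. Qed.

Lemma integrableD_EFin f g : mu.-integrable D (EFin \o f) ->
  mu.-integrable D (EFin \o g) ->
  mu.-integrable D (EFin \o (fun x => f x + g x)).
Proof. by move=> fi gi; exact: (integrableD mD fi gi). Qed.

Lemma integrableB_EFin f g : mu.-integrable D (EFin \o f) ->
  mu.-integrable D (EFin \o g) ->
  mu.-integrable D (EFin \o (fun x => f x - g x)).
Proof. by move=> fi gi; exact: (integrableB mD fi gi). Qed.

Lemma integrableZ_EFin f k : mu.-integrable D (EFin \o f) ->
  mu.-integrable D (EFin \o (fun x => k * f x)).
Proof. by move=> fi; exact: (integrableZl mD k fi). Qed.

Lemma le_integrable_EFin f g : measurable_fun D f ->
  (forall x, D x -> `|f x| <= g x) -> mu.-integrable D (EFin \o g) ->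
  mu.-integrable D (EFin \o f).
Proof.
move=> mf fg; apply: le_integrable => //; first exact/measurable_EFinP.
by move=> x Dx; rewrite /= lee_fin (le_trans (fg _ Dx))// ler_norm.
Qed.

Lemma integrable_sum_EFin (I : Type) (s : seq I) (h : I -> T -> R) :
  (forall i, mu.-integrable D (EFin \o h i)) ->
  mu.-integrable D (EFin \o (fun x => \sum_(i <- s) h i x)).
Proof.
move=> hi; rewrite (_ : _ \o _ = fun x => \sum_(i <- s) (h i x)%:E)%E.
  by apply: integrable_sum => // i _; exact: hi.
by apply/funext => x; rewrite sumEFin.
Qed.

Lemma Rintegral_sum (I : Type) (s : seq I) (h : I -> T -> R) :
  (forall i, mu.-integrable D (EFin \o h i)) ->
  \int[mu]_(x in D) (\sum_(i <- s) h i x) =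
  \sum_(i <- s) \int[mu]_(x in D) h i x.
Proof.
move=> hi; elim: s => [|i s IH].
  rewrite big_nil; under eq_Rintegral do rewrite big_nil.
  by rewrite /Rintegral integral0.
rewrite big_cons -IH -RintegralD//; last exact: integrable_sum_EFin.
by apply: eq_Rintegral => x _; rewrite big_cons.
Qed.

Lemma Rintegral_funrposneg f : mu.-integrable D (EFin \o f) ->
  \int[mu]_(x in D) f x =
  \int[mu]_(x in D) f^\+ x - \int[mu]_(x in D) f^\- x.
Proof.
move=> fi; rewrite -RintegralB//; last 2 first.
- exact: integrable_funrpos.
- exact: integrable_funrneg.
by apply: eq_Rintegral => x _; rewrite -[in LHS](funrposBneg f).
Qed.

Lemma ae_eq_Rintegral f g : measurable_fun D f -> measurable_fun D g ->
  {ae mu, forall x, D x -> f x = g x} ->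
  \int[mu]_(x in D) f x = \int[mu]_(x in D) g x.
Proof.
move=> mf mg fg; rewrite /Rintegral; congr fine.
apply: ae_eq_integral => //; [exact/measurable_EFinP|exact/measurable_EFinP|].
by apply: filterS fg => x + Dx => /(_ Dx) ->.
Qed.

Lemma ae_eq_integrable f g : measurable_fun D g ->
  {ae mu, forall x, D x -> f x = g x} ->
  mu.-integrable D (EFin \o f) -> mu.-integrable D (EFin \o g).
Proof.
move=> mg fg fi; have mf : measurable_fun D f.
  by apply/measurable_EFinP; exact: measurable_int fi.
have mabs h : measurable_fun D h -> measurable_fun D (fun x => `|(h x)%:E|%E).
  by move=> mh; apply: measurableT_comp => //; exact/measurable_EFinP.
have /integrableP[_ fi_lty] := fi.
apply/integrableP; split; first exact/measurable_EFinP.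
apply: le_lt_trans fi_lty; rewrite le_eqVlt; apply/orP; left; apply/eqP.
apply: ae_eq_integral => //; [exact: mabs|exact: mabs|].
by apply: filterS fg => x + Dx => /(_ Dx) /= ->.
Qed.

Lemma Rdominated_cvg (f_ : nat -> T -> R) f g :
  (forall n, measurable_fun D (f_ n)) -> measurable_fun D f ->
  {ae mu, forall x, D x -> f_ n x @[n --> \oo] --> f x} ->
  mu.-integrable D (EFin \o g) -> (forall n x, D x -> `|f_ n x| <= g x) ->
  \int[mu]_(x in D) f_ n x @[n --> \oo] --> \int[mu]_(x in D) f x.
Proof.
move=> mf_ mf cf ig fg.
have [] // := @dominated_convergence _ _ _ mu _ mD (fun n => EFin \o f_ n)
  (EFin \o f) (EFin \o g).
- by move=> n; apply/measurable_EFinP.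
- by apply/measurable_EFinP.
- apply: filterS cf => x + Dx => /(_ Dx) h.
  by apply: cvg_EFin; [exact: nearW|exact: h].
- by apply: aeW => x n Dx; rewrite /= lee_fin fg.
by move=> fi _ cint; apply: fine_cvg; rewrite EFin_Rintegral.
Qed.

Lemma Rdominated_cvg_sqrB (f_ : nat -> T -> R) f g :
  measurable_fun D f -> (forall n, measurable_fun D (f_ n)) ->
  {ae mu, forall x, D x -> f_ n x @[n --> \oo] --> f x} ->
  mu.-integrable D (EFin \o g) ->
  (forall n x, D x -> (f x - f_ n x) ^+ 2 <= g x) ->
  \int[mu]_(x in D) (f x - f_ n x) ^+ 2 @[n --> \oo] --> 0.
Proof.
move=> mf mf_ cf ig fg.
have int0 : \int[mu]_(x in D) cst 0 x = 0 by rewrite Rintegral_cst// mul0r.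
rewrite -[X in _ --> X]int0; apply: Rdominated_cvg ig _ => //.
- by move=> n; apply: measurable_funX; exact: measurable_funB.
- apply: filterS cf => x + Dx => /(_ Dx) cfx.
  rewrite /= (_ : 0 = (f x - f x) ^+ 2); last by rewrite subrr expr0n.
  have cB : f x - f_ n x @[n --> \oo] --> f x - f x.
    by apply: cvgB => //; exact: cvg_cst.
  exact: (cvg_comp _ (fun y => y ^+ 2) cB (@exprn_continuous _ 2 _)).
- by move=> n x Dx; rewrite ger0_norm ?sqr_ge0// fg.
Qed.

End RealIntegrals.

Section AllMoments.
Context d (T : measurableType d) (R : realType) (P : probability T R).
Implicit Types f g : T -> R.

Definition all_moments f := measurable_fun setT f /\
  forall m, P.-integrable setT (EFin \o (fun w => f w ^+ m)).

Lemma measurable_all_moments f : all_moments f -> measurable_fun setT f.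
Proof. by case. Qed.

Lemma integrable_moment f m : all_moments f ->
  P.-integrable setT (EFin \o (fun w => f w ^+ m)).
Proof. by case. Qed.

Lemma all_moments_int f : all_moments f -> P.-integrable setT (EFin \o f).
Proof. by move=> [_ /(_ 1%N)]. Qed.

Lemma all_moments_cst c : all_moments (cst c).
Proof. by split=> // m; exact: (finite_measure_integrable_cst _ (c ^+ m)). Qed.

Lemma le_normM_sqrD (a b : R) : `|a * b| <= a ^+ 2 + b ^+ 2.
Proof.
rewrite normrM -[a ^+ 2]real_normK ?num_real// -[b ^+ 2]real_normK ?num_real//.
by have := sqr_ge0 (`|a| - `|b|); have := normr_ge0 a; have := normr_ge0 b; nra.
Qed.

Lemma all_momentsM f g : all_moments f -> all_moments g ->
  all_moments (fun w => f w * g w).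
Proof.
move=> [mf fi] [mg gi]; split=> [|m]; first exact: measurable_funM.
apply: (@le_integrable_EFin _ _ _ _ _ measurableT _
  (fun w => f w ^+ (m * 2) + g w ^+ (m * 2))).
- by apply: measurable_funX; exact: measurable_funM.
- by move=> w _; rewrite exprMn !exprM; exact: le_normM_sqrD.
- exact: integrableD_EFin.
Qed.

Lemma normrX_addr_le (a b : R) m :
  `|a + b| ^+ m <= 2 ^+ m * (`|a| ^+ m + `|b| ^+ m).
Proof.
wlog ab : a b / `|a| <= `|b|.
  move=> le_ab; have [|/ltW] := leP `|a| `|b|; first exact: le_ab.
  by rewrite (addrC a) [X in _ <= _ * X]addrC; exact: le_ab.
apply: (@le_trans _ _ ((2 * `|b|) ^+ m)).
  rewrite lerXn2r ?nnegrE ?mulr_ge0// (le_trans (ler_normD _ _))//.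
  by rewrite mulr2n mulrDl mul1r lerD2r.
by rewrite exprMn ler_wpM2l ?exprn_ge0// lerDr exprn_ge0.
Qed.

Lemma all_momentsD f g : all_moments f -> all_moments g ->
  all_moments (fun w => f w + g w).
Proof.
move=> [mf fi] [mg gi]; split=> [|m]; first exact: measurable_funD.
apply: (@le_integrable_EFin _ _ _ _ _ measurableT _
  (fun w => 2 ^+ m * (`|f w ^+ m| + `|g w ^+ m|))).
- by apply: measurable_funX; exact: measurable_funD.
- by move=> w _; rewrite !normrX normrX_addr_le.
- apply: integrableZ_EFin => //; apply: integrableD_EFin => //.
    exact: (integrable_norm (fi m)).
  exact: (integrable_norm (gi m)).
Qed.

Lemma all_momentsZ f c : all_moments f -> all_moments (fun w => c * f w).
Proof. by move=> fL; apply: all_momentsM => //; exact: all_moments_cst. Qed.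

Lemma all_momentsX f n : all_moments f -> all_moments (fun w => f w ^+ n).
Proof.
move=> [mf fi]; split=> [|m]; first exact: measurable_funX.
have := fi (n * m)%N; congr (P.-integrable _ _).
by apply/funext => w /=; rewrite exprM.
Qed.

Lemma all_moments_sum (I : Type) (s : seq I) (Q : pred I) (F : I -> T -> R) :
  (forall i, all_moments (F i)) ->
  all_moments (fun w => \sum_(i <- s | Q i) F i w).
Proof.
move=> FL; elim: s => [|i s IH].
  rewrite (_ : (fun _ => _) = cst 0); first exact: all_moments_cst.
  by apply/funext => w; rewrite big_nil.
under eq_fun do rewrite big_cons.
by case: (Q i) => //; exact: all_momentsD.
Qed.

Lemma all_moments_prod (I : Type) (s : seq I) (Q : pred I) (F : I -> T -> R) :
  (forall i, all_moments (F i)) ->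
  all_moments (fun w => \prod_(i <- s | Q i) F i w).
Proof.
move=> FL; elim: s => [|i s IH].
  rewrite (_ : (fun _ => _) = cst 1); first exact: all_moments_cst.
  by apply/funext => w; rewrite big_nil.
under eq_fun do rewrite big_cons.
by case: (Q i) => //; exact: all_momentsM.
Qed.

Lemma all_moments_horner (Q : {poly R}) f : all_moments f ->
  all_moments (fun w => Q.[f w]).
Proof.
move=> fL; under eq_fun do rewrite horner_coef.
by apply: all_moments_sum => i; apply: all_momentsZ; exact: all_momentsX.
Qed.

End AllMoments.

Lemma measurable_fun_limn_einf d (T : measurableType d) (R : realType)
    (D : set T) (f : (T -> \bar R)^nat) :
  (forall n, measurable_fun D (f n)) ->
  measurable_fun D (fun x => limn_einf (f ^~ x)).
Proof.
move=> mf; under eq_fun do rewrite -[limn_einf _]oppeK -limn_esupN.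
apply: measurableT_comp => //; apply: measurable_fun_limn_esup => n.
exact: measurableT_comp.
Qed.

Section SquareIntegrableLimit.
Context d (T : measurableType d) (R : realType) (P : probability T R).

Lemma normr_le_1Dsqr (x : R) : `|x| <= 1 + x ^+ 2.
Proof.
rewrite -[x ^+ 2]real_normK ?num_real//.
by have := sqr_ge0 (`|x| - 1); nra.
Qed.

Lemma integrable_of_sqr (Y : T -> R) : measurable_fun setT Y ->
  P.-integrable setT (EFin \o (fun w => Y w ^+ 2)) ->
  P.-integrable setT (EFin \o Y).
Proof.
move=> mY iY2; apply: (@le_integrable_EFin _ _ _ P _ measurableT _
  (fun w => 1 + Y w ^+ 2)) => //.
  by move=> w _; exact: normr_le_1Dsqr.
by apply: integrableD_EFin => //; exact: (finite_measure_integrable_cst _ 1).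
Qed.

Variables (Y_ : nat -> T -> R) (Y : T -> R) (K : R).
Hypothesis mY_ : forall n, measurable_fun setT (Y_ n).
Hypothesis iY_2 : forall n, P.-integrable setT (EFin \o (fun w => Y_ n w ^+ 2)).
Hypothesis mY : measurable_fun setT Y.
Hypothesis cY : {ae P, forall w, Y_ n w @[n --> \oo] --> Y w}.
Hypothesis bY : forall n, \int[P]_w (Y_ n w ^+ 2) <= K.

Lemma integral_sqr_limit_le : (\int[P]_w (Y w ^+ 2)%:E <= K%:E)%E.
Proof.
have mY2 n : measurable_fun setT (fun w => (Y_ n w ^+ 2)%:E).
  by apply/measurable_EFinP; exact: measurable_funX.
have mlim : measurable_fun setT
    (fun w => limn_einf (fun n => (Y_ n w ^+ 2)%:E)).
  exact: measurable_fun_limn_einf.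
have -> : (\int[P]_w (Y w ^+ 2)%:E =
    \int[P]_w (limn_einf (fun n => (Y_ n w ^+ 2)%:E)))%E.
  apply: ae_eq_integral => //.
    by apply/measurable_EFinP; exact: measurable_funX.
  apply: filterS cY => w cYw _; apply/esym.
  have : (Y_ n w ^+ 2)%:E @[n --> \oo] --> (Y w ^+ 2)%:E.
    by apply: cvg_EFin; [exact: nearW|exact: cvgM].
  by move=> /cvg_limn_einf_sup[-> _].
apply: (@le_trans _ _ (limn_einf (fun n => \int[P]_w (Y_ n w ^+ 2)%:E)%E)).
  by apply: fatou => // n w _; rewrite lee_fin sqr_ge0.
rewrite limn_einf_lim; apply: lime_le; first exact: is_cvg_einfs.
apply: nearW => n; apply: (@le_trans _ _ (\int[P]_w (Y_ n w ^+ 2)%:E)%E).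
  by apply: ereal_inf_lbound; exists n => /=.
by rewrite -EFin_Rintegral ?lee_fin//; exact: iY_2.
Qed.

Lemma integrable_sqr_limit : P.-integrable setT (EFin \o (fun w => Y w ^+ 2)).
Proof.
apply/integrableP; split.
  by apply/measurable_EFinP; exact: measurable_funX.
under eq_integral => w _ do rewrite /= ger0_norm ?sqr_ge0//.
by apply: (le_lt_trans integral_sqr_limit_le); rewrite ltry.
Qed.

End SquareIntegrableLimit.

Section BoundedSecondMoment.
Context d (T : measurableType d) (R : realType) (P : probability T R).

Lemma integrable_minr (Z : T -> R) (k : R) : 0 <= k -> measurable_fun setT Z ->
  (forall w, 0 <= Z w) ->
  P.-integrable setT (EFin \o (fun w => Num.min (Z w) k)).
Proof.
move=> k0 mZ Z0; apply: (@le_integrable_EFin _ _ _ P _ measurableT _ (cst k)).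
- exact: measurable_minr.
- by move=> w _; rewrite ger0_norm ?ge_min ?lexx ?orbT// le_min Z0.
- exact: (finite_measure_integrable_cst _ k).
Qed.

Lemma Rintegral_le_minr (Z : T -> R) (k : R) : 0 < k -> measurable_fun setT Z ->
  (forall w, 0 <= Z w) -> P.-integrable setT (EFin \o (fun w => Z w ^+ 2)) ->
  \int[P]_w Z w <= \int[P]_w (Num.min (Z w) k) + k^-1 * \int[P]_w (Z w ^+ 2).
Proof.
move=> k0 mZ Z0 iZ2; have im := integrable_minr (ltW k0) mZ Z0.
rewrite -RintegralZl// -RintegralD//; last exact: integrableZ_EFin.
apply: le_Rintegral => //; first exact: integrable_of_sqr.
  by apply: integrableD_EFin => //; exact: integrableZ_EFin.
move=> w _; have [Zk|kZ] := leP (Z w) k.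
  by rewrite lerDl mulr_ge0 ?invr_ge0 ?sqr_ge0// ltW.
apply: (@le_trans _ _ (k^-1 * Z w ^+ 2)); last by rewrite lerDr ltW.
by rewrite mulrC ler_pdivlMr// expr2 ler_wpM2l// ltW.
Qed.

(* Vitali's theorem in the easy case. *)
Lemma cvg0_Rintegral_bounded_sqr (Z_ : nat -> T -> R) (K : R) :
  (forall n, measurable_fun setT (Z_ n)) -> (forall n w, 0 <= Z_ n w) ->
  {ae P, forall w, Z_ n w @[n --> \oo] --> (0 : R)} ->
  (forall n, P.-integrable setT (EFin \o (fun w => Z_ n w ^+ 2))) ->
  (forall n, \int[P]_w (Z_ n w ^+ 2) <= K) ->
  \int[P]_w Z_ n w @[n --> \oo] --> (0 : R).
Proof.
move=> mZ Z0 cZ iZ2 bZ; have K0 : 0 <= K.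
  by apply: le_trans (bZ 0%N); apply: Rintegral_ge0 => w _; exact: sqr_ge0.
apply/cvgrPdist_lt => e e0.
pose k := 2 * K / e + 1; have k0 : 0 < k.
  by rewrite ltr_wpDl// divr_ge0 ?mulr_ge0// ltW.
have Kk : k^-1 * K < e / 2.
  rewrite ltr_pdivrMl// (_ : k * (e / 2) = K + e / 2); last first.
    by rewrite /k; field; rewrite gt_eqF.
  by rewrite ltrDl divr_gt0.
have cmin : \int[P]_w (Num.min (Z_ n w) k) @[n --> \oo] --> (0 : R).
  have -> : (0 : R) = \int[P]_w cst 0 w by rewrite Rintegral_cst// mul0r.
  apply: (@Rdominated_cvg _ _ _ P _ measurableT
    (fun n w => Num.min (Z_ n w) k) (cst 0) (cst k)) => //.
  - by move=> n; apply: measurable_minr.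
  - apply: filterS cZ => w cZw _.
    apply: (@squeeze_cvgr _ _ _ _ (cst 0) (Z_ ^~ w)) => //; last exact: cvg_cst.
    by apply: nearW => n; rewrite le_min Z0 ltW//= ge_min lexx.
  - exact: (finite_measure_integrable_cst _ k).
  - by move=> n w _; rewrite ger0_norm ?ge_min ?lexx ?orbT// le_min Z0 ltW.
have e20 : 0 < e / 2 by rewrite divr_gt0.
have /cvgrPdist_lt/(_ _ e20) := cmin; apply: filterS => n.
rewrite !sub0r !normrN => min_lt.
rewrite ger0_norm; last by apply: Rintegral_ge0 => w _; exact: Z0.
apply: (le_lt_trans (Rintegral_le_minr k0 (mZ n) (Z0 n) (iZ2 n))).
rewrite (splitr e) ltrD// ?(le_lt_trans (ler_norm _) min_lt)//.
by apply: le_lt_trans Kk; rewrite ler_wpM2l// invr_ge0 ltW.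
Qed.

Lemma sqrB_le (a b : R) : (a - b) ^+ 2 <= 2 * a ^+ 2 + 2 * b ^+ 2.
Proof. by have := sqr_ge0 (a + b); nra. Qed.

Lemma cvg_Rintegral_bounded_sqr (Y_ : nat -> T -> R) (Y : T -> R) (K : R) :
  (forall n, measurable_fun setT (Y_ n)) ->
  (forall n, P.-integrable setT (EFin \o (fun w => Y_ n w ^+ 2))) ->
  measurable_fun setT Y -> {ae P, forall w, Y_ n w @[n --> \oo] --> Y w} ->
  (forall n, \int[P]_w (Y_ n w ^+ 2) <= K) ->
  \int[P]_w Y_ n w @[n --> \oo] --> \int[P]_w Y w.
Proof.
move=> mY_ iY_2 mY cY bY.
have iY2 := integrable_sqr_limit mY_ iY_2 mY cY bY.
have EY2 : \int[P]_w (Y w ^+ 2) <= K.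
  rewrite -lee_fin EFin_Rintegral//.
  exact: (integral_sqr_limit_le mY_ iY_2 mY cY bY).
have iY := integrable_of_sqr mY iY2.
have iY_ n := integrable_of_sqr (mY_ n) (iY_2 n).
pose Z n w := `|Y_ n w - Y w|.
have Z2 n w : Z n w ^+ 2 = (Y_ n w - Y w) ^+ 2 by rewrite real_normK ?num_real.
have mZ n : measurable_fun setT (Z n).
  by apply: measurableT_comp => //; exact: measurable_funB.
have idom n := integrableD_EFin measurableT
  (integrableZ_EFin measurableT 2 (iY_2 n))
  (integrableZ_EFin measurableT 2 iY2).
have iZ2 n : P.-integrable setT (EFin \o (fun w => Z n w ^+ 2)).
  apply: le_integrable_EFin (idom n) => //; first exact: measurable_funX.
  by move=> w _; rewrite Z2 ger0_norm ?sqr_ge0// sqrB_le.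
have cZ : \int[P]_w Z n w @[n --> \oo] --> (0 : R).
  apply: (cvg0_Rintegral_bounded_sqr (K := 4 * K)) => //.
  - by move=> n w; exact: normr_ge0.
  - apply: filterS cY => w cYw; rewrite -(normr0 R) -(subrr (Y w)).
    by apply: cvg_norm; apply: cvgB => //; exact: cvg_cst.
  - move=> n.
    apply: (@le_trans _ _ (\int[P]_w (2 * Y_ n w ^+ 2 + 2 * Y w ^+ 2))).
      by apply: le_Rintegral => // w _; rewrite Z2 sqrB_le.
    rewrite RintegralD// ?RintegralZl//; [|exact: integrableZ_EFin..].
    by have := bY n; lra.
rewrite -[X in _ --> X]subr0; apply/subr_cvg0/norm_cvg0P.
apply: (@squeeze_cvgr _ _ _ _ (cst 0) (fun n => \int[P]_w Z n w)).
- apply: nearW => n; rewrite normr_ge0/= subr0 -RintegralB//.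
  by apply: le_normr_Rintegral => //; exact: integrableB_EFin.
- exact: cvg_cst.
- exact: cZ.
Qed.

End BoundedSecondMoment.

(** * Moments of the normal distribution *)

Section IntegralOfDerivative.
Context {R : realType}.
Notation mu := (@lebesgue_measure R).
Implicit Types F f : R -> R.

Lemma is_derive_continuous F f :
  (forall x : R, is_derive x 1 F (f x)) -> continuous F.
Proof.
move=> dF x; apply/differentiable_continuous/derivable1_diffP.
by have [] := dF x.
Qed.

Lemma Rintegral_is_derive F f (a b : R) : a <= b ->
  (forall x : R, is_derive x 1 F (f x)) -> continuous f ->
  \int[mu]_(x in `[a, b]) f x = F b - F a.
Proof.
rewrite le_eqVlt => /predU1P[<-|ab] dF cf.
  by rewrite set_itv1 Rintegral_set1 subrr.
have cF := is_derive_continuous dF.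
rewrite /Rintegral (@continuous_FTC2 _ _ F)//.
- exact: continuous_subspaceT.
- split; [by move=> x _; have [] := dF x| |].
    by apply: cvg_at_right_filter; exact: cF.
  by apply: cvg_at_left_filter; exact: cF.
- by move=> x _; rewrite derive1E; have [_ ->] := dF x.
Qed.

Lemma Rintegral_is_derive_vanishing F f :
  (forall x : R, is_derive x 1 F (f x)) -> continuous f ->
  mu.-integrable setT (EFin \o f) ->
  F n%:R @[n --> \oo] --> 0 -> F (- n%:R) @[n --> \oo] --> 0 ->
  \int[mu]_x f x = 0.
Proof.
move=> dF cf fi Foo FNoo.
have mf : measurable_fun setT f by exact: continuous_measurable_fun.
pose g n := f \_ (`[- n%:R, n%:R] : set R).
have intg n : \int[mu]_x g n x = F n%:R - F (- n%:R).
  by rewrite -Rintegral_mkcond (Rintegral_is_derive _ dF)// ge0_cp.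
have cg : \int[mu]_x g n x @[n --> \oo] --> \int[mu]_x f x.
  apply: (@Rdominated_cvg _ _ _ mu _ measurableT g f (fun x => `|f x|)) => //.
  - move=> n; apply/(measurable_restrictT _ _).1 => //.
    exact: measurable_funTS.
  - apply: aeW => x _; apply: cvg_near_cst.
    exists (Num.truncn `|x|).+1 => // n /= xn.
    rewrite /g patchE ifT// inE/= in_itv/= -ler_norml.
    by apply: ltW; apply: lt_le_trans (truncnS_gt _) _; rewrite ler_nat.
  - exact: (integrable_norm fi).
  - by move=> n x _; rewrite /g patchE; case: ifPn => //= _; rewrite normr0.
have cF : F n%:R - F (- n%:R) @[n --> \oo] --> (0 : R).
  by rewrite -[X in _ --> X](subr0 0); exact: cvgB.
rewrite (funext intg) in cg; exact: (cvg_unique _ cg cF).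
Qed.

End IntegralOfDerivative.

Section NormalDensity.
Context {R : realType}.
Notation mu := (@lebesgue_measure R).
Implicit Types x : R.

Lemma normrX_le_expR (c x : R) m : 0 < c ->
  `|x| ^+ m <= (1 + c ^+ m.+1 * (m.+1)`!%:R) * expR (x ^+ 2 / c).
Proof.
move=> c0; set y := x ^+ 2 / c.
have y0 : 0 <= y by rewrite divr_ge0 ?sqr_ge0// ltW.
have xE : (x ^+ 2) ^+ m.+1 = c ^+ m.+1 * y ^+ m.+1.
  by rewrite -exprMn /y mulrC divfK// gt_eqF.
have xm : `|x| ^+ m <= 1 + (x ^+ 2) ^+ m.+1.
  have [x1|x1] := leP `|x| 1.
    apply: (@le_trans _ _ 1); first by rewrite exprn_ile1.
    by rewrite lerDl exprn_ge0// sqr_ge0.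
  rewrite -[x ^+ 2]real_normK ?num_real// -exprM.
  apply: (@le_trans _ _ (`|x| ^+ (2 * m.+1))); last by rewrite lerDr.
  by apply: ler_weXn2l; [exact: ltW|lia].
have ey := expR_ge1Dxn m y0.
apply: (le_trans xm); rewrite xE mulrDl mul1r; apply: lerD.
  by apply: le_trans ey; rewrite lerDl divr_ge0// exprn_ge0.
rewrite -mulrA ler_wpM2l ?exprn_ge0 ?(ltW c0)//.
rewrite mulrC -ler_pdivrMr ?ltr0n ?fact_gt0//.
by apply: le_trans ey; rewrite lerDr.
Qed.

Variable s : R.
Hypothesis s0 : 0 < s.

Let sN0 : s != 0. Proof. by rewrite gt_eqF. Qed.

Lemma normrX_normal_pdf_le m : exists2 C, 0 <= C & forall x,
  `|x| ^+ m * normal_pdf 0 s x <= C * normal_pdf 0 (Num.sqrt 2 * s) x.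
Proof.
have s20 : 0 < Num.sqrt 2 * s by rewrite mulr_gt0// sqrtr_gt0.
have peak0 := normal_peak_gt0 sN0.
have peak20 := normal_peak_gt0 (lt0r_neq0 s20).
have s24 : 0 < 4 * s ^+ 2 by rewrite mulr_gt0// exprn_gt0.
pose K := 1 + (4 * s ^+ 2) ^+ m.+1 * (m.+1)`!%:R.
have K0 : 0 <= K by rewrite addr_ge0// mulr_ge0// exprn_ge0// ltW.
exists (K * normal_peak s / normal_peak (Num.sqrt 2 * s)).
  by rewrite divr_ge0 ?mulr_ge0// ltW.
move=> x; rewrite !normal_pdfE ?gt_eqF// mulrCA !mulrA divfK ?gt_eqF//.
rewrite -[leLHS]mulrA (mulrC K) -mulrA ler_pM2l//.
rewrite /normal_fun exprMn sqr_sqrtr// subr0.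
set y := x ^+ 2 / (4 * s ^+ 2).
have -> : - x ^+ 2 / (s ^+ 2 *+ 2) = - y - y by rewrite /y; field.
have -> : - x ^+ 2 / ((2 * s ^+ 2) *+ 2) = - y by rewrite /y; field.
rewrite expRD mulrA ler_pM2r ?expR_gt0// expRN ler_pdivrMr ?expR_gt0//.
exact: normrX_le_expR.
Qed.

Lemma integrable_exprn_normal_pdf m :
  mu.-integrable setT (EFin \o (fun x => x ^+ m * normal_pdf 0 s x)).
Proof.
have [C C0 leC] := normrX_normal_pdf_le m.
apply: (@le_integrable_EFin _ _ _ mu _ measurableT _
  (fun x => C * normal_pdf 0 (Num.sqrt 2 * s) x)) => //.
- by apply: measurable_funM => //; exact: measurable_normal_pdf.
- move=> x _; rewrite normrM normrX (ger0_norm (normal_pdf_ge0 _ _ _)).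
  exact: leC.
- by apply: integrableZ_EFin => //; exact: integrable_normal_pdf.
Qed.

Lemma exprn_normal_pdf_vanishing (u : R^nat) k :
  `|u n| @[n --> \oo] --> +oo ->
  u n ^+ k * normal_pdf 0 s (u n) @[n --> \oo] --> 0.
Proof.
move=> uoo; have [C C0 leC] := normrX_normal_pdf_le k.+1.
set D := C * normal_peak (Num.sqrt 2 * s).
have u0 : \forall n \near \oo, 0 < `|u n| by move/cvgryPgt : uoo; exact.
apply/norm_cvg0P.
apply: (@squeeze_cvgr _ _ _ _ (cst 0) (fun n => D * `|u n|^-1)).
- apply: filterS u0 => n un0; rewrite normr_ge0/= ler_pdivlMr//.
  rewrite normrM normrX mulrAC -exprSr (ger0_norm (normal_pdf_ge0 _ _ _)).
  apply: (le_trans (leC _)); rewrite ler_wpM2l// normal_pdf_ub//.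
  by rewrite mulf_neq0// gt_eqF// sqrtr_gt0.
- exact: cvg_cst.
- rewrite -[X in _ --> X](mulr0 D); apply: cvgM; first exact: cvg_cst.
  by apply/gtr0_cvgV0.
Qed.

Lemma is_derive_normal_pdf x :
  is_derive x 1 (normal_pdf 0 s) (- x / s ^+ 2 * normal_pdf 0 s x).
Proof.
have -> : normal_pdf 0 s =
    (fun x => normal_peak s *
              (expR \o (fun y => - (s ^+ 2 *+ 2)^-1 * y ^+ 2)) x).
  rewrite normal_pdfE//; apply/funext => y; congr (_ * expR _).
  by rewrite subr0 !mulNr mulrC.
have h : is_derive x 1 (fun y => - (s ^+ 2 *+ 2)^-1 * y ^+ 2) (- x / s ^+ 2).
  by apply: is_derive_eq; rewrite /GRing.scale/=; field.
have h2 := @is_derive1_comp _ expR _ x _ _ (is_derive_expR _) h.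
by apply: is_derive_eq; rewrite /GRing.scale/=; ring.
Qed.

Lemma is_derive_exprn_normal_pdf k x :
  is_derive x 1 (fun x => x ^+ k * normal_pdf 0 s x)
    (k%:R * (x ^+ k.-1 * normal_pdf 0 s x) +
     - s ^- 2 * (x ^+ k.+1 * normal_pdf 0 s x)).
Proof.
have -> : (fun x => x ^+ k * normal_pdf 0 s x) =
    (id : R -> R) ^+ k * normal_pdf 0 s by apply/funext => y; rewrite !fctE.
have dX := is_deriveX k (is_derive_id x 1).
apply: (is_derive_eq (is_deriveM dX (is_derive_normal_pdf x))).
rewrite /GRing.scale/= !fctE [x ^+ k.+1]exprS.
set a := x ^+ k; set b := x ^+ k.-1; set c := normal_pdf 0 s x.
by field.
Qed.

Lemma Rintegral_exprS_normal_pdf k :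
  \int[mu]_x (x ^+ k.+1 * normal_pdf 0 s x) =
  k%:R * s ^+ 2 * \int[mu]_x (x ^+ k.-1 * normal_pdf 0 s x).
Proof.
have i1 := integrable_exprn_normal_pdf k.-1.
have i2 := integrable_exprn_normal_pdf k.+1.
have j1 := integrableZ_EFin measurableT k%:R i1.
have j2 := integrableZ_EFin measurableT (- s ^- 2) i2.
have cX j : continuous (fun x => x ^+ j * normal_pdf 0 s x).
  by move=> x; apply: cvgM;
    [exact: exprn_continuous|exact: continuous_normal_pdf].
have := @Rintegral_is_derive_vanishing _ _ _ (is_derive_exprn_normal_pdf k).
rewrite RintegralD// !RintegralZl// => ibp.
have {ibp}/eqP : k%:R * \int[mu]_x (x ^+ k.-1 * normal_pdf 0 s x) +
    - s ^- 2 * \int[mu]_x (x ^+ k.+1 * normal_pdf 0 s x) = 0.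
  apply: ibp.
  - by move=> x; apply: cvgD; apply: cvgM; (try exact: cvg_cst); exact: cX.
  - exact: integrableD_EFin.
  - apply: exprn_normal_pdf_vanishing; under eq_fun do rewrite normr_nat.
    exact: cvgr_idn.
  - apply: (@exprn_normal_pdf_vanishing (fun n => - n%:R)).
    by under eq_fun do rewrite normrN normr_nat; exact: cvgr_idn.
rewrite addr_eq0 mulNr opprK => /eqP e.
by rewrite mulrAC e mulrC mulrA divff ?expf_neq0// mul1r.
Qed.

Lemma normal_pdf_moment m :
  \int[mu]_x (x ^+ m * normal_pdf 0 s x) = gauss_moment (s ^+ 2) m.
Proof.
pose J k := \int[mu]_x (x ^+ k * normal_pdf 0 s x).
suff: J m = gauss_moment (s ^+ 2) m /\ J m.+1 = gauss_moment (s ^+ 2) m.+1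
  by case.
elim: m => [|m [IH1 IH2]].
  rewrite /J Rintegral_exprS_normal_pdf !mul0r gauss_moment0 gauss_moment_odd//.
  split=> //; rewrite /Rintegral.
  by under eq_integral do rewrite expr0 mul1r; rewrite integral_normal_pdf.
by split=> //; rewrite /J Rintegral_exprS_normal_pdf -/(J m) IH1 gauss_momentSS.
Qed.

End NormalDensity.

Section Density.
Context d (T : measurableType d) (R : realType).
Variables (nu : {finite_measure set T -> \bar R}).
Variables (mu : {sigma_finite_measure set T -> \bar R}) (p : T -> R).
Hypotheses (p0 : forall x, 0 <= p x) (ip : mu.-integrable setT (EFin \o p)).
Hypothesis nuE : forall A, measurable A ->
  nu A = (\int[mu]_(x in A) (p x)%:E)%E.

Let nu_mu : nu `<< mu.
Proof.
apply/null_content_dominatesP => A mA muA0; rewrite nuE//.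
by apply: null_set_integral => //;
  exact: measurable_funTS (measurable_int _ ip).
Qed.

Lemma ge0_integral_density (f : T -> R) : measurable_fun setT f ->
  (forall x, 0 <= f x) ->
  (\int[nu]_x (f x)%:E = \int[mu]_x (f x * p x)%:E)%E.
Proof.
move=> mf f0; pose h := Radon_Nikodym_SigmaFinite.f nu mu.
have ih : mu.-integrable setT h.
  by exact: Radon_Nikodym_SigmaFinite.f_integrable.
have mEf : measurable_fun setT (EFin \o f) by exact/measurable_EFinP.
have hp : ae_eq mu setT h (EFin \o p).
  apply: integral_ae_eq => //; first exact: measurable_int ip.
  by move=> A _ mA; rewrite -Radon_Nikodym_SigmaFinite.f_integral// nuE.
rewrite -(Radon_Nikodym_SigmaFinite.change_of_variables nu_mu)//.
apply: ae_eq_integral => //.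
- by apply: emeasurable_funM => //; exact: measurable_int ih.
- apply/measurable_EFinP; apply: measurable_funM => //.
  by apply/measurable_EFinP; exact: measurable_int ip.
- by apply: filterS hp => x + Dx => /(_ Dx); rewrite /h/= => ->; rewrite -EFinM.
Qed.

Lemma integrable_density (f : T -> R) : measurable_fun setT f ->
  mu.-integrable setT (EFin \o (fun x => f x * p x)) ->
  nu.-integrable setT (EFin \o f).
Proof.
move=> mf /integrableP[_ fp_lty]; apply/integrableP.
split; first exact/measurable_EFinP.
rewrite (ge0_integral_density (f := fun x => `|f x|))//.
  by under eq_integral do rewrite -(ger0_norm (p0 _)) -normrM.
exact: measurableT_comp.
Qed.

Lemma Rintegral_density (f : T -> R) : measurable_fun setT f ->
  mu.-integrable setT (EFin \o (fun x => f x * p x)) ->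
  \int[nu]_x f x = \int[mu]_x (f x * p x).
Proof.
move=> mf ifp; have inu := integrable_density mf ifp.
rewrite (Rintegral_funrposneg _ inu)// (Rintegral_funrposneg _ ifp)//.
rewrite /Rintegral; congr (fine _ - fine _).
  rewrite ge0_integral_density//; last exact: measurable_funrpos.
  by apply: eq_integral => x _; rewrite /funrpos maxr_pMl// mul0r.
rewrite ge0_integral_density//; last exact: measurable_funrneg.
by apply: eq_integral => x _; rewrite /funrneg -mulNr maxr_pMl// mul0r.
Qed.

End Density.

(** * Independence *)

Section Independence.
Context d (T : measurableType d) (R : realType) (P : probability T R).
Implicit Types U V : T -> R.

Definition independent_rv U V := forall A B : set R,
  measurable A -> measurable B ->
  P (U @^-1` A `&` V @^-1` B) = (P (U @^-1` A) * P (V @^-1` B))%E.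

Lemma independent_rv_comp U V (f g : R -> R) :
  measurable_fun setT f -> measurable_fun setT g ->
  independent_rv U V -> independent_rv (f \o U) (g \o V).
Proof.
move=> mf mg UV A B mA mB; apply: (UV (f @^-1` A) (g @^-1` B)).
  by rewrite -[X in measurable X]setTI; exact: mf.
by rewrite -[X in measurable X]setTI; exact: mg.
Qed.

Lemma independent_g_sigma_algebra (G : set (set T)) (E : set T) :
  G `<=` measurable -> setI_closed G -> G setT -> measurable E ->
  (forall A, G A -> P (A `&` E) = (P A * P E)%E) ->
  forall A, <<s G >> A -> P (A `&` E) = (P A * P E)%E.
Proof.
move=> Gm GI GT mE GE; have PE := fine_ge0 (measure_ge0 P E).
have fPE : P E = (fine (P E))%:E by rewrite fineK// fin_num_measure.
suff unique : forall A, <<s G >> A -> mrestr P mE A = mscale (NngNum PE) P A.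
  move=> A GA; rewrite -[LHS]/(mrestr P mE A) unique//= /mscale/= -fPE.
  exact: muleC.
apply: (g_sigma_algebra_measure_unique G Gm (fun=> setT)) => //.
- by rewrite bigcup_const//; exists 0%N.
- by move=> A GA; rewrite /= /mrestr GE// /mscale/= -fPE muleC.
- move=> _; rewrite /= /mrestr setTI.
  apply: le_lt_trans (probability_le1 P mE) _.
  exact: ltry.
Qed.

Lemma independent_joint_distribution (X Y : {RV P >-> R})
    (XY : {RV P >-> (R * R)%type}) : (forall w, XY w = (X w, Y w)) ->
  independent_rv X Y -> forall C, measurable C ->
  (distribution P X \x distribution P Y)%E C = distribution P XY C.
Proof.
move=> XYE indXY C mC.
apply: (@product_measure_unique _ _ _ _ _ (distribution P X) (distribution P Y)
  (distribution P XY)) => // A B mA mB.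
rewrite /= /distribution/= /pushforward -indXY//; congr (P _).
by apply/seteqP; split=> w; rewrite /= XYE.
Qed.

Lemma Rintegral_independentM U V :
  measurable_fun setT U -> measurable_fun setT V ->
  independent_rv U V -> P.-integrable setT (EFin \o U) ->
  P.-integrable setT (EFin \o V) ->
  P.-integrable setT (EFin \o (fun w => U w * V w)) ->
  \int[P]_w (U w * V w) = \int[P]_w U w * \int[P]_w V w.
Proof.
move=> mU mV UV iU iV iUV.
pose X : {RV P >-> R} := mfun_Sub (mem_set mU).
pose Y : {RV P >-> R} := mfun_Sub (mem_set mV).
have mXY : measurable_fun setT (fun w => (U w, V w)).
  by exact: measurable_fun_pair.
pose XY : {RV P >-> (R * R)%type} := mfun_Sub (mem_set mXY).
pose f (z : R * R) : \bar R := (z.1 * z.2)%:E.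
have mf : measurable_fun setT f.
  apply/measurable_EFinP; apply: measurable_funM.
    exact: measurable_fst.
  exact: measurable_snd.
have lawXY C : measurable C -> C `<=` setT ->
    (distribution P X \x distribution P Y)%E C = distribution P XY C.
  by move=> mC _; exact: independent_joint_distribution.
apply: EFin_inj; rewrite EFinM !EFin_Rintegral//.
transitivity (\int[distribution P XY]_z f z)%E.
  by rewrite integral_distribution.
rewrite -(eq_measure_integral _ lawXY) -integral12_prod_meas1; last first.
  apply/integrableP; split=> //; rewrite (eq_measure_integral _ lawXY).
  rewrite ge0_integral_distribution//; last exact: measurableT_comp.
  by have /integrableP[] := iUV.
transitivity (\int[distribution P X]_x (x%:E * (\int[P]_w V w)%:E))%E.
  apply: eq_integral => x _; rewrite /fubini_F /f/= EFin_Rintegral//.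
  rewrite (eq_integral (fun y => x%:E * y%:E)%E); last first.
    by move=> y _; rewrite EFinM.
  rewrite integralZl//; last exact: (integrable_pushforward (phi := Y)).
  by rewrite integral_distribution.
rewrite integralZr//; last exact: (integrable_pushforward (phi := X)).
by rewrite integral_distribution// EFin_Rintegral.
Qed.

End Independence.

(** * Sums and limits of Gaussian variables *)

Section IndependentFamily.
Context d (T : measurableType d) (R : realType) (P : probability T R).
Variables (N : nat) (xi : nat -> T -> R).
Variable nu : nat -> probability (measurableTypeR R) R.
Hypothesis mxi : forall i, measurable_fun setT (xi i).
Hypothesis law : forall B : nat -> set R, (forall i, measurable (B i)) ->
  P [set w | forall i, (i < N)%N -> B i (xi i w)] =
  (\prod_(i < N) nu i (B i))%E.

Let mxi_preimage i (B : set R) : measurable B -> measurable (xi i @^-1` B).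
Proof. by move=> mB; rewrite -[X in measurable X]setTI; exact: mxi. Qed.

Let law_factor r (rN : (r < N)%N) (B : nat -> set R) C :
  (forall i, measurable (B i)) -> measurable C -> B r = setT ->
  P ([set w | forall i, (i < N)%N -> B i (xi i w)] `&` xi r @^-1` C) =
  (nu r C * P [set w | forall i, (i < N)%N -> B i (xi i w)])%E.
Proof.
move=> mB mC Br; pose B' i := if i == r then C else B i.
have mB' i : measurable (B' i) by rewrite /B'; case: ifP.
rewrite (_ : _ `&` _ = [set w | forall i, (i < N)%N -> B' i (xi i w)]).
  rewrite !law// (bigD1 (Ordinal rN))//= [in RHS](bigD1 (Ordinal rN))//=.
  rewrite /B' eqxx Br probability_setT mul1e; congr (_ * _)%E.
  apply: eq_bigr => i ir; rewrite (_ : (i == r :> nat) = false)//.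
  exact/negbTE.
apply/seteqP; split=> w /=.
  by move=> [Bw Cw] i iN; rewrite /B'; case: eqP => [->//|_]; exact: Bw.
move=> B'w; split=> [i iN|]; last by have := B'w r rN; rewrite /B' eqxx.
have [->|ir] := eqVneq i r; first by rewrite Br.
by have := B'w i iN; rewrite /B' (negbTE ir).
Qed.

Lemma independent_family_marginal r (C : set R) : (r < N)%N -> measurable C ->
  P (xi r @^-1` C) = nu r C.
Proof.
move=> rN mC; have := law_factor rN (fun=> measurableT) mC erefl.
rewrite (_ : [set w | _] = setT) ?setTI ?probability_setT ?mule1//.
by apply/seteqP; split.
Qed.

Lemma independent_family_partial_sum r (a : nat -> R) : (r < N)%N ->
  independent_rv P (fun w => \sum_(i < r) a i * xi i w) (xi r).
Proof.
move=> rN A C mA mC.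
pose cyl (B : nat -> set R) := [set w | forall i, (i < r)%N -> B i (xi i w)].
pose G : set (set T) := [set cyl B | B in [set B | forall i, measurable (B i)]].
have cylE B : cyl B =
    [set w | forall i, (i < N)%N -> (if (i < r)%N then B i else setT) (xi i w)].
  apply/seteqP; split=> w Bw i ir; first by case: ifPn => // /Bw.
  by have := Bw i (ltn_trans ir rN); rewrite ir.
have mif (B : nat -> set R) i : (forall i, measurable (B i)) ->
    measurable (if (i < r)%N then B i else setT) by case: ifP.
have Gm : G `<=` measurable.
  move=> _ [B mB <-]; rewrite (_ : cyl B = \bigcap_(i < r) (xi i @^-1` B i))//.
  by apply: bigcap_measurableType => i _; exact: mxi_preimage.
have GI : setI_closed G.
  move=> _ _ [B mB <-] [B' mB' <-]; exists (fun i => B i `&` B' i).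
    by move=> i; exact: measurableI.
  apply/seteqP; split=> w; first by move=> BB'w; split=> i /BB'w[].
  by move=> [Bw B'w] i ir; split; [exact: Bw|exact: B'w].
have GT : G setT by exists (fun=> setT) => //; apply/seteqP; split.
have GC D : G D -> P (D `&` xi r @^-1` C) = (P D * P (xi r @^-1` C))%E.
  move=> [B mB <-]; rewrite independent_family_marginal// muleC cylE.
  by rewrite (law_factor rN (fun i => mif B i mB))// ltnn.
apply: (independent_g_sigma_algebra Gm GI GT _ GC); first exact: mxi_preimage.
have mxiG (i : 'I_r) : measurable_fun [set: g_sigma_algebraType G] (xi i).
  move=> _ B mB; rewrite setTI; apply: sub_sigma_algebra.
  exists (fun j => if j == i :> nat then B else setT).
    by move=> j; case: ifP.
  apply/seteqP; split=> w /=; first by move=> /(_ i (ltn_ord i)); rewrite eqxx.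
  by move=> Bw j _; case: eqP => // ->.
have mS : measurable_fun [set: g_sigma_algebraType G]
    (fun w => \sum_(i < r) a i * xi i w).
  by apply: measurable_sum => i; exact: measurable_funM.
by rewrite -[X in <<s G >> X]setTI; exact: mS.
Qed.

End IndependentFamily.

Section GaussianMoments.
Context d (T : measurableType d) (R : realType) (P : probability T R).
Implicit Types (U V Y : T -> R) (v w : R).

Definition gaussian_moments v Y :=
  all_moments P Y /\ forall m, \int[P]_x (Y x ^+ m) = gauss_moment v m.

Lemma gaussian_moments_cst0 : gaussian_moments 0 (cst 0).
Proof.
split=> [|m]; first exact: all_moments_cst.
by rewrite gauss_moment_var0 /= Rintegral_cst//= probability_setT mulr1.
Qed.

Lemma gaussian_momentsZ b v Y :
  gaussian_moments v Y -> gaussian_moments (b ^+ 2 * v) (fun x => b * Y x).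
Proof.
move=> [LY EY]; split=> [|m]; first exact: all_momentsZ.
under eq_Rintegral do rewrite exprMn.
by rewrite RintegralZl ?EY ?gauss_momentZ//; exact: integrable_moment.
Qed.

Lemma gaussian_momentsD v w U V : independent_rv P U V ->
  gaussian_moments v U -> gaussian_moments w V ->
  gaussian_moments (v + w) (fun x => U x + V x).
Proof.
move=> UV [LU EU] [LV EV]; split=> [|m]; first exact: all_momentsD.
have LUV j k : all_moments P (fun x => U x ^+ j * V x ^+ k).
  by apply: all_momentsM; exact: all_momentsX.
have EUV j k : \int[P]_x (U x ^+ j * V x ^+ k) =
    gauss_moment v j * gauss_moment w k.
  rewrite Rintegral_independentM ?EU ?EV//.
  - exact: measurable_all_moments (all_momentsX j LU).
  - exact: measurable_all_moments (all_momentsX k LV).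
  - exact: (independent_rv_comp
      (f := fun x => x ^+ j) (g := fun x => x ^+ k)).
  - exact: integrable_moment.
  - exact: integrable_moment.
  - exact: all_moments_int.
transitivity (\int[P]_x \sum_(k < m.+1)
  'C(m, k)%:R * (U x ^+ k * V x ^+ (m - k))).
  apply: eq_Rintegral => x _; rewrite addrC exprDn; apply: eq_bigr => k _.
  by rewrite -mulr_natl [V x ^+ _ * _]mulrC.
have iUV j k := all_moments_int (LUV j k).
rewrite Rintegral_sum//; last by move=> k; exact: integrableZ_EFin.
by rewrite -gauss_momentD; apply: eq_bigr => k _; rewrite RintegralZl// EUV.
Qed.

(* [measurableTypeR R], on which [normal_prob] lives, and the canonical
   measurable structure of [R] differ by their displays. *)
Lemma gaussian_moments_normal (s : R) Y : 0 < s -> measurable_fun setT Y ->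
  (forall A, measurable A -> P (Y @^-1` A) = normal_prob 0 s A) ->
  gaussian_moments (s ^+ 2) Y.
Proof.
move=> s0 mY law; pose M : measurableType _ := measurableTypeR R.
have mYM : @measurable_fun _ _ T M setT Y by exact: mY.
pose X : {RV P >-> M} := @mfun_Sub _ _ T M Y (mem_set mYM).
have lawX (A : set M) : measurable A -> A `<=` setT ->
    distribution P X A = normal_prob 0 s A by move=> mA _; exact: law.
pose power m (x : M) : R := x ^+ m.
have mpower m : measurable_fun setT (power m) by exact: measurable_funX.
have imom m : (normal_prob 0 s).-integrable setT (EFin \o power m).
  apply: (@integrable_density _ M _ (normal_prob 0 s) (@lebesgue_measure R)
    (normal_pdf 0 s)) => //.
  - exact: normal_pdf_ge0.
  - exact: integrable_normal_pdf.
  - exact: integrable_exprn_normal_pdf.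
have iY m : P.-integrable setT (EFin \o (fun x => Y x ^+ m)).
  apply/integrableP; split.
    by apply/measurable_EFinP; exact: measurable_funX.
  have -> : (\int[P]_x `|(Y x ^+ m)%:E| =
      \int[normal_prob 0 s]_x `|(power m x)%:E|)%E.
    rewrite -(eq_measure_integral _ lawX) ge0_integral_distribution//.
    by apply: measurableT_comp => //; exact/measurable_EFinP.
  by have /integrableP[_] := imom m.
split=> // m; rewrite -(normal_pdf_moment s0).
transitivity (\int[normal_prob 0 s]_x power m x).
  rewrite /Rintegral -(eq_measure_integral _ lawX) integral_distribution//.
    exact/measurable_EFinP.
  exact: iY.
apply: (@Rintegral_density _ M _ (normal_prob 0 s) (@lebesgue_measure R)
  (normal_pdf 0 s)) => //.
- exact: normal_pdf_ge0.
- exact: integrable_normal_pdf.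
- exact: integrable_exprn_normal_pdf.
Qed.

Section IndependentNormals.
Variables (N : nat) (xi : nat -> T -> R) (s : nat -> R).
Hypothesis mxi : forall i, measurable_fun setT (xi i).
Hypothesis s0 : forall i, (i < N)%N -> 0 < s i.
Hypothesis law : forall B : nat -> set R, (forall i, measurable (B i)) ->
  P [set x | forall i, (i < N)%N -> B i (xi i x)] =
  (\prod_(i < N) normal_prob 0 (s i) (B i))%E.

Lemma gaussian_moments_sum (a : nat -> R) : gaussian_moments
  (\sum_(i < N) a i ^+ 2 * s i ^+ 2) (fun x => \sum_(i < N) a i * xi i x).
Proof.
suff partial r : (r <= N)%N ->
    gaussian_moments (\sum_(i < r) a i ^+ 2 * s i ^+ 2)
      (fun x => \sum_(i < r) a i * xi i x) by exact: partial.
elim: r => [|r IH] rN.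
  rewrite big_ord0 (_ : (fun _ => _) = cst 0).
    exact: gaussian_moments_cst0.
  by apply/funext => x; rewrite big_ord0.
rewrite big_ord_recr/= (_ : (fun x => \sum_(i < r.+1) a i * xi i x) =
    fun x => \sum_(i < r) a i * xi i x + a r * xi r x); last first.
  by apply/funext => x; rewrite big_ord_recr.
have normal_r : gaussian_moments (s r ^+ 2) (xi r).
  apply: gaussian_moments_normal => //; first exact: s0.
  move=> A mA.
  exact: (independent_family_marginal (nu := fun i => normal_prob 0 (s i)) law).
apply: gaussian_momentsD; [|exact/IH/ltnW|exact: gaussian_momentsZ].
have indep := independent_family_partial_sum
  (nu := fun i => normal_prob 0 (s i)) mxi law a rN.
apply: (independent_rv_comp (f := idfun) (g := *%R (a r)) _ _ indep).
  exact: measurable_id.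
exact: mulrl_measurable.
Qed.

End IndependentNormals.

Lemma gaussian_moments_limit (Y_ : nat -> T -> R) Y (v_ : nat -> R) v :
  (forall n, gaussian_moments (v_ n) (Y_ n)) -> v_ n @[n --> \oo] --> v ->
  measurable_fun setT Y -> {ae P, forall x, Y_ n x @[n --> \oo] --> Y x} ->
  gaussian_moments v Y.
Proof.
move=> gY cv mY cY.
have mY_ m n : measurable_fun setT (fun x => Y_ n x ^+ m).
  by apply: measurable_funX; exact: measurable_all_moments (gY n).1.
have iY_2 m n : P.-integrable setT (EFin \o (fun x => (Y_ n x ^+ m) ^+ 2)).
  by apply: integrable_moment; apply: all_momentsX; exact: (gY n).1.
have mYm m : measurable_fun setT (fun x => Y x ^+ m) by exact: measurable_funX.
have cYm m : {ae P, forall x, Y_ n x ^+ m @[n --> \oo] --> Y x ^+ m}.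
  apply: filterS cY => x cYx.
  exact: (cvg_comp (Y_ ^~ x) (fun y => y ^+ m) cYx
    (@exprn_continuous _ m (Y x))).
have cvm m : gauss_moment (v_ n) m @[n --> \oo] --> gauss_moment v m.
  exact: (cvg_comp v_ (gauss_moment ^~ m) cv (@gauss_moment_continuous _ m v)).
have bounded m : exists K, forall n, \int[P]_x ((Y_ n x ^+ m) ^+ 2) <= K.
  have /cvg_seq_bounded[M [_ /(_ (M + 1))]] := cvgP _ (cvm (m * 2)%N).
  rewrite ltrDl ltr01 => /(_ isT) le_M; exists (M + 1) => n.
  under eq_Rintegral do rewrite -exprM.
  by have [_ ->] := gY n; exact: (le_trans (ler_norm _) (le_M n I)).
split=> [|m].
  split=> // m; have [K leK] := bounded m; apply: integrable_of_sqr => //.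
  exact: (integrable_sqr_limit (mY_ m) (iY_2 m) (mYm m) (cYm m) leK).
have [K leK] := bounded m.
have cE := cvg_Rintegral_bounded_sqr (mY_ m) (iY_2 m) (mYm m) (cYm m) leK.
apply: (cvg_unique _ cE) => //.
rewrite (_ : (fun n => _) = (fun n => gauss_moment (v_ n) m)); first exact: cvm.
by apply/funext => n; exact: (gY n).2.
Qed.

End GaussianMoments.

(** * Riemann-Stieltjes sums *)

Section ContinuousOnSegment.
Context {R : realType}.
Notation mu := (@lebesgue_measure R).
Implicit Types (f g x : R -> R) (a b : R).

Lemma integrable_continuous_segment f a b : continuous f ->
  mu.-integrable `[a, b] (EFin \o f).
Proof.
move=> cf; apply: continuous_compact_integrable; first exact: segment_compact.
exact: continuous_subspaceT.
Qed.

Lemma continuous_segment_bounded f a b : continuous f -> a <= b ->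
  exists M, forall t, a <= t <= b -> `|f t| <= M.
Proof.
move=> cf ab; have cnf : {within `[a, b], continuous (fun t => `|f t|)}.
  by apply: continuous_subspaceT => t; apply: cvg_norm; exact: cf.
have [c _ fc] := EVT_max ab cnf; exists `|f c| => t tab.
by apply: fc; rewrite in_itv.
Qed.

Lemma continuous_segment_unif_continuous f a b : continuous f ->
  forall e, 0 < e -> exists2 de, 0 < de &
    forall s t, a <= s <= b -> `|s - t| < de -> `|f s - f t| <= e.
Proof.
move=> cf e e0; have e20 : 0 < e / 2 by rewrite divr_gt0.
pose close de s := forall t, `|s - t| < de -> `|f s - f t| <= e.
have covering := (compact_near_coveringP _).1 (@segment_compact _ a b).
have near_close s0 : `[a, b]%classic s0 ->
    \forall s \near s0 & de \near 0^'+, close de s.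
  move=> _; have /cvgrPdist_lt/(_ _ e20)/nbhs_ballP[r /= r0 fr] := cf s0.
  have r20 : 0 < r / 2 by rewrite divr_gt0.
  exists (ball s0 (r / 2), [set de | de < r / 2]) => /=.
    by split; [exact: nbhsx_ballx|exact: nbhs_right_lt].
  move=> [s de] /= [s0s de_r] t st.
  have s0t : ball s0 r t.
    rewrite /ball/= -(subrKA s) (splitr r) (le_lt_trans (ler_normD _ _))//.
    by rewrite ltrD// (lt_trans st).
  have s0s' : ball s0 r s.
    by apply: le_ball s0s; rewrite ler_pdivrMr// ler_peMr ?ler1n// ltW.
  rewrite -(subrKA (f s0)) (splitr e) (le_trans (ler_normD _ _))//.
  by rewrite lerD// ?[`|f s - _|]distrC ltW//; exact: fr.
have /filter_ex[de [de0 deP]] :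
    \forall de \near 0^'+, 0 < de /\ `[a, b]%classic `<=` close de.
  by apply: filterI; [exact: nbhs_right_gt|exact: covering near_close].
by exists de => // s t sab; apply: deP; rewrite /= in_itv.
Qed.

Lemma Rintegral_tag_error x phi g (tau a b e M : R) : a <= b ->
  continuous x -> (forall t : R, is_derive t 1 phi (g t)) -> continuous g ->
  (forall t, a <= t <= b -> `|x t - x tau| <= e) ->
  (forall t, a <= t <= b -> `|g t| <= M) ->
  `|\int[mu]_(t in `[a, b]) (x t * g t) - x tau * (phi b - phi a)| <=
    e * M * (b - a).
Proof.
move=> ab cx dphi cg xe gM.
have cxg : continuous (fun t => (x t - x tau) * g t).
  by move=> t; apply: cvgM; [apply: cvgB; [exact: cx|exact: cvg_cst]|exact: cg].
have ixg : mu.-integrable `[a, b] (EFin \o (fun t => x t * g t)).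
  by apply: integrable_continuous_segment => t; apply: cvgM;
    [exact: cx|exact: cg].
have ig := @integrable_continuous_segment g a b cg.
rewrite -(Rintegral_is_derive ab dphi cg) -RintegralZl//.
rewrite -RintegralB//; last exact: integrableZ_EFin.
under eq_Rintegral do rewrite -mulrBl.
have ixgB := @integrable_continuous_segment _ a b cxg.
apply: (le_trans (le_normr_Rintegral _ ixgB)) => //.
apply: (@le_trans _ _ (\int[mu]_(t in `[a, b]) (e * M))).
  apply: le_Rintegral => //.
  - exact: (integrable_norm ixgB).
  - apply: (@integrable_continuous_segment (cst (e * M))).
    exact: cst_continuous.
  - by move=> t; rewrite /= in_itv/= normrM => tab; rewrite ler_pM// ?xe ?gM.
rewrite Rintegral_cst//= lebesgue_measure_itv/= lte_fin.
by move: ab; rewrite le_eqVlt => /predU1P[->|->]; rewrite ?ltxx ?subrr.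
Qed.

Lemma Rintegral_itv_cat f a b c : continuous f -> a <= b -> b <= c ->
  \int[mu]_(t in `[a, c]) f t - \int[mu]_(t in `[a, b]) f t =
  \int[mu]_(t in `[b, c]) f t.
Proof.
move=> cf ab bc; have iac := @integrable_continuous_segment f a c cf.
rewrite Rintegral_itvB ?bnd_simp// Rintegral_itv_obnd_cbnd//.
apply: integrableS iac => //; apply: subset_itv; rewrite bnd_simp//.
Qed.

End ContinuousOnSegment.

Section StieltjesSums.
Context {R : realType} (T : R).
Hypothesis T0 : 0 < T.
Notation mu := (@lebesgue_measure R).
Implicit Types (f g x phi : R -> R) (tag : nat -> nat -> R).

Definition node (N i : nat) : R := i%:R * T / N%:R.

Lemma node0 N : node N 0 = 0.
Proof. by rewrite /node !mul0r. Qed.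

Lemma node_last N : (0 < N)%N -> node N N = T.
Proof. by move=> N0; rewrite /node mulrC mulKf// pnatr_eq0 -lt0n. Qed.

Lemma nodeS N i : node N i.+1 - node N i = T / N%:R.
Proof. by rewrite /node -!mulrBl -natrB// subSnn mul1r. Qed.

Lemma node_leS N i : node N i <= node N i.+1.
Proof. by rewrite -subr_ge0 nodeS divr_ge0// ltW. Qed.

Lemma node_segment N i : (i <= N)%N -> 0 <= node N i <= T.
Proof.
move=> iN; have [N0|N0] := posnP N.
  by move: iN; rewrite N0 leqn0 => /eqP ->; rewrite node0 lexx ltW.
rewrite divr_ge0 ?mulr_ge0 ?(ltW T0)//= ler_pdivrMr ?ltr0n//.
by rewrite mulrC ler_wpM2l ?(ltW T0)// ler_nat.
Qed.

Lemma tagged_sum_cvg x phi g tag : continuous x ->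
  (forall t : R, is_derive t 1 phi (g t)) -> continuous g ->
  (forall N i, (i < N)%N -> node N i <= tag N i <= node N i.+1) ->
  \sum_(i < N) x (tag N i) * (phi (node N i.+1) - phi (node N i)) @[N --> \oo]
  --> \int[mu]_(t in `[0, T]) (x t * g t).
Proof.
move=> cx dphi cg tagP; apply/cvgrPdist_le => e e0.
have [M gM] := continuous_segment_bounded cg (ltW T0).
have M0 : 0 <= M by apply: (le_trans (normr_ge0 _) (gM 0 _)); rewrite lexx ltW.
pose e' := e / (M * T + 1).
have MT0 : 0 < M * T + 1 by rewrite ltr_wpDl// mulr_ge0// ltW.
have e'0 : 0 < e' by rewrite divr_gt0.
have [de de0 unif] := @continuous_segment_unif_continuous _ x 0 T cx e' e'0.
exists (Num.truncn (T / de)).+1 => // N /= NN.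
have N0 : (0 < N)%N by exact: leq_ltn_trans NN.
have TN : T / N%:R < de.
  rewrite ltr_pdivrMr ?ltr0n// mulrC -ltr_pdivrMr//.
  by apply: (lt_le_trans (truncnS_gt _)); rewrite ler_nat.
pose H t := \int[mu]_(r in `[0, t]) (x r * g r).
have cxg : continuous (fun t => x t * g t).
  by move=> t; apply: cvgM; [exact: cx|exact: cg].
have -> : \int[mu]_(t in `[0, T]) (x t * g t) =
    \sum_(i < N) (H (node N i.+1) - H (node N i)).
  rewrite -(big_mkord xpredT (fun i => H (node N i.+1) - H (node N i))).
  rewrite (telescope_sumr (fun i => H (node N i)))// node_last// node0.
  by rewrite {2}/H set_itv1 Rintegral_set1 subr0.
rewrite -sumrB (le_trans (ler_norm_sum _ _ _))//.
apply: (@le_trans _ _ (\sum_(i < N) e' * M * (T / N%:R))).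
  apply: ler_sum => i _; have /andP[tag1 tag2] := tagP N i (ltn_ord i).
  have /andP[u0 _] := node_segment (ltnW (ltn_ord i)).
  have /andP[_ uT] := node_segment (ltn_ord i).
  have seg t : node N i <= t <= node N i.+1 -> 0 <= t <= T.
    by move=> /andP[ut tu]; rewrite (le_trans u0 ut) (le_trans tu uT).
  rewrite Rintegral_itv_cat ?node_leS// -(nodeS N i).
  apply: Rintegral_tag_error => // [|t tu|t /seg tT]; last exact: gM.
    exact: node_leS.
  apply: unif; first exact: seg.
  apply: le_lt_trans TN; rewrite -(nodeS N i).
  by move: tu tag1 tag2 => /andP[]; rewrite ler_norml; lra.
rewrite sumr_const card_ord -[_ *+ N]mulr_natr -mulrA divfK ?pnatr_eq0 -?lt0n//.
by rewrite /e' -mulrA mulrAC ler_pdivrMr// ler_wpM2l ?(ltW e0)// lerDl.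
Qed.

Lemma riemann_sum_cvg f : continuous f ->
  \sum_(i < N) f (node N i) * (T / N%:R) @[N --> \oo] -->
  \int[mu]_(t in `[0, T]) f t.
Proof.
move=> cf.
have -> : \int[mu]_(t in `[0, T]) f t = \int[mu]_(t in `[0, T]) (f t * cst 1 t).
  by apply: eq_Rintegral => t _; rewrite mulr1.
rewrite (_ : (fun N => _) = fun N => \sum_(i < N) f (node N i) *
    (idfun (node N i.+1) - idfun (node N i))); last first.
  by apply/funext => N; apply: eq_bigr => i _; rewrite /= nodeS.
apply: tagged_sum_cvg => // [t|N i _]; first exact: cvg_cst.
by rewrite lexx node_leS.
Qed.

Lemma RS_sum_by_parts phi x N : (0 < N)%N ->
  RS_sum T phi x N = phi T * x T - phi 0 * x 0 -
    \sum_(i < N) x (node N i.+1) * (phi (node N i.+1) - phi (node N i)).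
Proof.
move=> N0; pose f i := phi (node N i) * x (node N i).
transitivity (\sum_(i < N) (f i.+1 - f i) -
    \sum_(i < N) x (node N i.+1) * (phi (node N i.+1) - phi (node N i))).
  by rewrite -sumrB; apply: eq_bigr => i _; rewrite /f /node; ring.
rewrite -(big_mkord xpredT (fun i => f i.+1 - f i)) telescope_sumr//.
by rewrite /f node_last// node0.
Qed.

Lemma RS_sum_cvg phi g x : (forall t : R, is_derive t 1 phi (g t)) ->
  continuous g -> continuous x ->
  RS_sum T phi x N @[N --> \oo] -->
  phi T * x T - phi 0 * x 0 - \int[mu]_(t in `[0, T]) (x t * g t).
Proof.
move=> dphi cg cx.
have parts : {near \oo, (fun N => phi T * x T - phi 0 * x 0 -
    \sum_(i < N) x (node N i.+1) * (phi (node N i.+1) - phi (node N i)))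
    =1 RS_sum T phi x}.
  by exists 1%N => // N /= N0; rewrite RS_sum_by_parts.
apply: cvg_trans (near_eq_cvg parts) _; apply: cvgB; first exact: cvg_cst.
apply: (@tagged_sum_cvg x phi g (fun N i => node N i.+1)) => // N i _.
by rewrite node_leS lexx.
Qed.

Lemma RS_sum_linearr phi x y c N :
  RS_sum T phi (fun t => y t + c * x t) N =
  RS_sum T phi y N + c * RS_sum T phi x N.
Proof.
by rewrite /RS_sum mulr_sumr -big_split/=; apply: eq_bigr => i _; ring.
Qed.

Lemma RS_sum_suml (I : Type) (s : seq I) (b : I -> R) (phi : I -> R -> R) x N :
  RS_sum T (fun t => \sum_(i <- s) b i * phi i t) x N =
  \sum_(i <- s) b i * RS_sum T (phi i) x N.
Proof.
rewrite /RS_sum; under eq_bigr do rewrite mulr_suml.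
rewrite exchange_big/=; apply: eq_bigr => i _; rewrite mulr_sumr.
by apply: eq_bigr => k _; rewrite mulrA.
Qed.

End StieltjesSums.

(** * The cosine system *)

Section L2Segment.
Context {R : realType} (T : R).
Hypothesis T0 : 0 < T.
Notation mu := (@lebesgue_measure R).
Notation D := (`[0, T] : set R).
Implicit Types u v f g : R -> R.

Let mD : measurable (D : set (measurableTypeR R)).
Proof. exact: measurable_itv. Qed.

Lemma integrable_cst_segment c : mu.-integrable D (EFin \o cst c).
Proof.
by apply: (@integrable_continuous_segment _ (cst c)) => t; exact: cvg_cst.
Qed.

Lemma integrable_inL2M u v : inL2 T u -> inL2 T v ->
  mu.-integrable D (EFin \o (fun t => u t * v t)).
Proof.
move=> [meas_u iu] [mv iv].
apply: (@le_integrable_EFin _ _ _ mu _ mD _ (fun t => u t ^+ 2 + v t ^+ 2)).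
- exact: measurable_funM.
- by move=> t _; exact: le_normM_sqrD.
- exact: integrableD_EFin.
Qed.

Lemma inL2_bounded u K : measurable_fun D u -> (forall t, D t -> `|u t| <= K) ->
  inL2 T u.
Proof.
move=> meas_u uK; split => //.
apply: (@le_integrable_EFin _ _ _ mu _ mD _ (cst (K ^+ 2))).
- exact: measurable_funX.
- by move=> t Dt; rewrite normrX lerXn2r ?nnegrE ?uK// (le_trans _ (uK t Dt)).
- exact: integrable_cst_segment.
Qed.

Lemma inL2_continuous u : continuous u -> inL2 T u.
Proof.
move=> cu; have [M uM] := continuous_segment_bounded cu (ltW T0).
apply: (@inL2_bounded _ M).
  by apply: measurable_funTS; exact: continuous_measurable_fun.
by move=> t; rewrite /= in_itv; exact: uM.
Qed.

Lemma inL2_indic (A : set R) : measurable A -> inL2 T (\1_A : R -> R).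
Proof.
move=> mA; apply: (@inL2_bounded _ 1) => //.
by move=> t _; rewrite indicE; case: (_ \in _); rewrite ?normr1 ?normr0.
Qed.

Lemma le_inL2 u v : measurable_fun D v -> (forall t, D t -> `|v t| <= `|u t|) ->
  inL2 T u -> inL2 T v.
Proof.
move=> mv vu [meas_u iu]; split=> //.
apply: (@le_integrable_EFin _ _ _ mu _ mD _ (fun t => u t ^+ 2)) => //.
  exact: measurable_funX.
move=> t Dt; rewrite -[leRHS]ger0_norm ?sqr_ge0// !normrX.
by rewrite lerXn2r ?nnegrE ?vu.
Qed.

Lemma inL2D u v : inL2 T u -> inL2 T v -> inL2 T (fun t => u t + v t).
Proof.
move=> Lu Lv; have [meas_u iu] := Lu; have [mv iv] := Lv.
split; first exact: measurable_funD.
have iuv := integrable_inL2M Lu Lv.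
have := integrableD_EFin mD (integrableD_EFin mD iu iv)
  (integrableZ_EFin mD 2 iuv).
congr (_.-integrable _ _); apply/funext => t /=; congr EFin; ring.
Qed.

Lemma inL2Z u c : inL2 T u -> inL2 T (fun t => c * u t).
Proof.
move=> [meas_u iu]; split; first exact: measurable_funM.
have := integrableZ_EFin mD (c ^+ 2) iu.
by congr (_.-integrable _ _); apply/funext => t /=; congr EFin; rewrite exprMn.
Qed.

Lemma inL2B u v : inL2 T u -> inL2 T v -> inL2 T (fun t => u t - v t).
Proof.
move=> Lu /(inL2Z (-1)) Lv; have := inL2D Lu Lv.
by congr inL2; apply/funext => t; rewrite mulN1r.
Qed.

Lemma inL2_sum (I : Type) (r : seq I) (F : I -> R -> R) :
  (forall i, inL2 T (F i)) -> inL2 T (fun t => \sum_(i <- r) F i t).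
Proof.
move=> FL; elim: r => [|i r IH].
  under eq_fun do rewrite big_nil; apply: inL2_continuous => t; exact: cvg_cst.
by under eq_fun do rewrite big_cons; exact: inL2D.
Qed.

Lemma L2ipC u v : L2ip T u v = L2ip T v u.
Proof. by apply: eq_Rintegral => t _; rewrite mulrC. Qed.

Lemma L2ip_suml (I : Type) (r : seq I) (b : I -> R) (f : I -> R -> R) v :
  (forall i, inL2 T (f i)) -> inL2 T v ->
  L2ip T (fun t => \sum_(i <- r) b i * f i t) v =
  \sum_(i <- r) b i * L2ip T (f i) v.
Proof.
move=> Lf Lv; have ifv i := integrable_inL2M (Lf i) Lv; rewrite /L2ip.
transitivity (\int[mu]_(t in D) \sum_(i <- r) b i * (f i t * v t)).
  apply: eq_Rintegral => t _; rewrite mulr_suml.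
  by apply: eq_bigr => i _; rewrite mulrA.
rewrite Rintegral_sum//; last by move=> i; exact: integrableZ_EFin.
by apply: eq_bigr => i _; rewrite RintegralZl.
Qed.

Lemma L2ip_orthonormal_comb n (e : 'I_n -> R -> R) (b : 'I_n -> R) :
  L2orthonormal T e ->
  L2ip T (fun t => \sum_j b j * e j t) (fun t => \sum_j b j * e j t) =
  \sum_j b j ^+ 2.
Proof.
move=> [Le ee].
have Lu : inL2 T (fun t => \sum_j b j * e j t).
  by apply: inL2_sum => j; exact: inL2Z.
rewrite L2ip_suml//; apply: eq_bigr => j _; rewrite L2ipC L2ip_suml//.
rewrite (bigD1 j)//= big1; first by rewrite ee eqxx mulr1 addr0 expr2.
by move=> i ij; rewrite ee (negbTE ij) mulr0.
Qed.

End L2Segment.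

Section CosineSystem.
Context {R : realType} (T : R).
Hypothesis T0 : 0 < T.
Notation mu := (@lebesgue_measure R).

Definition cosk (k : nat) (t : R) : R := cos (k%:R * pi * t / T).

Definition cos_norm (k : nat) : R :=
  if k == 0%N then (Num.sqrt T)^-1 else Num.sqrt (2 / T).

Lemma cons_basisE k t : cons_basis T k t = cos_norm k * cosk k t.
Proof.
rewrite /cons_basis /cos_norm /cosk; case: eqP => [->|//].
by rewrite !mul0r cos0 mulr1.
Qed.

Lemma cosk0 t : cosk 0 t = 1.
Proof. by rewrite /cosk !mul0r cos0. Qed.

Lemma cosk_bounded k t : -1 <= cosk k t <= 1.
Proof. by rewrite cos_geN1 cos_le1. Qed.

Let freq k : R := k%:R * pi / T.

Let is_derive_freq k (t : R) : is_derive t 1 (fun t => freq k * t) (freq k).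
Proof.
have := @is_deriveZ _ _ _ (@idfun R) (freq k) t 1 1 (is_derive_id t 1).
by rewrite /GRing.scale/= mulr1.
Qed.

Let coskE k : cosk k = cos \o (fun t => freq k * t).
Proof. by apply/funext => t; rewrite /cosk /freq /= mulrAC. Qed.

Lemma is_derive_cosk k (t : R) :
  is_derive t 1 (cosk k) (- (freq k * sin (freq k * t))).
Proof.
rewrite coskE.
have := @is_derive1_comp _ cos _ t _ _ (is_derive_cos _) (is_derive_freq k t).
by move=> h; apply: (is_derive_eq h); rewrite mulNr mulrC.
Qed.

Lemma continuous_cosk k : continuous (cosk k).
Proof. exact: is_derive_continuous (is_derive_cosk k). Qed.

Lemma cons_basis_C1 k : exists2 g : R -> R,
  (forall t : R, is_derive t 1 (cons_basis T k) (g t)) & continuous g.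
Proof.
exists (fun t => cos_norm k * (- (freq k * sin (freq k * t)))) => t.
  rewrite (_ : cons_basis T k = cos_norm k *: cosk k).
    exact: is_deriveZ (is_derive_cosk k t).
  by apply/funext => s; rewrite cons_basisE.
apply: cvgM; first exact: cvg_cst.
apply: cvgN; apply: cvgM; first exact: cvg_cst.
have cfreq : freq k * s @[s --> t] --> freq k * t.
  by apply: cvgM; [exact: cvg_cst|exact: cvg_id].
exact: (cvg_comp _ _ cfreq (@continuous_sin _ (freq k * t))).
Qed.

Lemma continuous_cons_basis k : continuous (cons_basis T k).
Proof. by have [g dg _] := cons_basis_C1 k; exact: is_derive_continuous dg. Qed.

Lemma sin_natmul_pi (k : nat) : sin (k%:R * pi) = 0 :> R.
Proof.
elim: k => [|k IH]; first by rewrite mul0r sin0.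
by rewrite -natr1 mulrDl mul1r sinDpi IH oppr0.
Qed.

Lemma Rintegral_cosk k : \int[mu]_(t in `[0, T]) cosk k t = (k == 0%N)%:R * T.
Proof.
have [->|k0] := eqVneq k 0%N.
  under eq_Rintegral do rewrite cosk0.
  by rewrite Rintegral_cst//= lebesgue_measure_itv/= lte_fin T0 -EFinB subr0.
have freqN0 : freq k != 0.
  by rewrite /freq !mulf_neq0// ?pnatr_eq0// ?invr_eq0 gt_eqF// pi_gt0.
have primitive (t : R) : is_derive t 1
    (fun t => (freq k)^-1 * sin (freq k * t)) (cosk k t).
  have h := @is_derive1_comp _ sin _ t _ _ (is_derive_sin _)
    (is_derive_freq k t).
  apply: (is_derive_eq (@is_deriveZ _ _ _ _ (freq k)^-1 t 1 _ h)).
  by rewrite coskE /GRing.scale/= mulrCA mulVf// mulr1.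
rewrite (Rintegral_is_derive (ltW T0) primitive (@continuous_cosk k)).
rewrite (_ : freq k * T = k%:R * pi); last by rewrite /freq divfK// gt_eqF.
by rewrite sin_natmul_pi !mulr0 sin0 mulr0 subr0 mul0r.
Qed.

Lemma coskM k l t : cosk k t * cosk l t =
  2^-1 * (cosk (k + l) t + cosk ((k - l) + (l - k)) t).
Proof.
have cosM (a b : R) : cos a * cos b = 2^-1 * (cos (a + b) + cos (a - b)).
  by rewrite cosD cosB; field.
rewrite {1 2}/cosk cosM; congr (_ * (_ + _)).
  by rewrite /cosk natrD; congr cos; ring.
have [kl|lk] := leqP k l.
  rewrite (eqP kl) add0n /cosk natrB//= -cosN.
  by congr cos; ring.
rewrite [(l - k)%N](eqP (ltnW lk)) addn0 /cosk natrB ?(ltnW lk)//.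
by congr cos; ring.
Qed.

Lemma cos_norm_sqr k : cos_norm k ^+ 2 * ((k == 0%N)%:R + 1) * T = 2.
Proof.
rewrite /cos_norm; case: eqP => _.
  rewrite exprVn sqr_sqrtr ?(ltW T0)// mulrAC mulVf ?gt_eqF// mul1r.
  by rewrite /= mulr1n -mulr2n.
by rewrite sqr_sqrtr ?divr_ge0 ?(ltW T0)// add0r mulr1 divfK// gt_eqF.
Qed.

Lemma cos_norm_neq0 k : cos_norm k != 0.
Proof.
have := cos_norm_sqr k; apply: contra_eq_neq => ->.
by rewrite expr0n !mul0r eq_sym pnatr_eq0.
Qed.

Lemma L2ip_cons_basis k l :
  L2ip T (cons_basis T k) (cons_basis T l) = (k == l)%:R.
Proof.
have icosk m := @integrable_continuous_segment _ _ 0 T (@continuous_cosk m).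
rewrite /L2ip; under eq_Rintegral do rewrite !cons_basisE mulrACA coskM mulrA.
rewrite RintegralZl//; last exact: integrableD_EFin.
rewrite RintegralD// !Rintegral_cosk addn_eq0 addn_eq0 !subn_eq0 -eqn_leq.
have [<-|kl] := eqVneq k l.
  rewrite andbb -mulrDl mulr1n.
  transitivity (cos_norm k ^+ 2 * ((k == 0%N)%:R + 1) * T / 2); first by ring.
  by rewrite cos_norm_sqr divff.
rewrite (_ : _ && _ = false) ?mul0r ?addr0 ?mulr0//.
by apply: contra_neqF kl => /andP[/eqP -> /eqP ->].
Qed.

Lemma L2orthonormal_cons_basis N :
  L2orthonormal T (fun k : 'I_N => cons_basis T k).
Proof.
split=> [k|i j]; last exact: L2ip_cons_basis.
exact/(inL2_continuous T0)/continuous_cons_basis.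
Qed.

Definition cos_poly N (b : nat -> R) t := \sum_(k < N) b k * cons_basis T k t.

Lemma continuous_cos_poly N b : continuous (cos_poly N b).
Proof.
rewrite /cos_poly; elim: N => [|N IH] t.
  by under eq_fun do rewrite big_ord0; exact: cvg_cst.
under eq_fun do rewrite big_ord_recr/=; apply: cvgD; first exact: IH.
by apply: cvgM; [exact: cvg_cst|exact: continuous_cons_basis].
Qed.

Lemma L2ip_cos_poly N b :
  L2ip T (cos_poly N b) (cos_poly N b) = \sum_(k < N) b k ^+ 2.
Proof.
exact: (L2ip_orthonormal_comb T0 (fun k : 'I_N => b k)
  (L2orthonormal_cons_basis N)).
Qed.

Lemma riemann_sum_cos_poly N b :
  \sum_(i < M) cos_poly N b (node T M i) ^+ 2 * (T / M%:R) @[M --> \oo] -->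
  \sum_(k < N) b k ^+ 2.
Proof.
rewrite -L2ip_cos_poly; apply: (@riemann_sum_cvg _ T T0) => t.
by apply: cvgM; exact: continuous_cos_poly.
Qed.

Definition cos_span N (f : R -> R) := exists b, forall t, f t = cos_poly N b t.

Lemma cos_spanD N f g : cos_span N f -> cos_span N g ->
  cos_span N (fun t => f t + g t).
Proof.
move=> [b fb] [c gc]; exists (fun k => b k + c k) => t.
by rewrite fb gc -big_split/=; apply: eq_bigr => k _; rewrite mulrDl.
Qed.

Lemma cos_spanZ N f a : cos_span N f -> cos_span N (fun t => a * f t).
Proof.
move=> [b fb]; exists (fun k => a * b k) => t.
by rewrite fb mulr_sumr; apply: eq_bigr => k _; rewrite mulrA.
Qed.

Lemma cos_span_sum N (I : Type) (r : seq I) (F : I -> R -> R) :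
  (forall i, cos_span N (F i)) -> cos_span N (fun t => \sum_(i <- r) F i t).
Proof.
move=> FN; elim: r => [|i r [b IH]].
  by exists (fun=> 0) => t; rewrite big_nil [RHS]big1// => k _; rewrite mul0r.
under eq_fun do rewrite big_cons; apply: cos_spanD => //; by exists b.
Qed.

Lemma cos_span_cosk N k : (k < N)%N -> cos_span N (cosk k).
Proof.
move=> kN; exists (fun j => if j == k then (cos_norm k)^-1 else 0) => t.
rewrite /cos_poly (bigD1 (Ordinal kN))//= eqxx big1 ?addr0.
  by rewrite cons_basisE mulKf ?cos_norm_neq0.
by move=> j jk; rewrite ifN ?mul0r.
Qed.

Lemma cos_span_widen N M f : (N <= M)%N -> cos_span N f -> cos_span M f.
Proof.
move=> NM [b fb].
apply: (_ : f = (fun t => \sum_(k < N) b k * cons_basis T k t) -> _).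
  move=> ->; apply: cos_span_sum => k; apply: cos_spanZ.
  rewrite (_ : cons_basis T k = fun t => cos_norm k * cosk k t).
    by apply: cos_spanZ; apply: cos_span_cosk; exact: leq_trans NM.
  by apply/funext => t; rewrite cons_basisE.
by apply/funext => t; rewrite fb.
Qed.

Lemma cos_span_mul_cosk1 N f : cos_span N f ->
  cos_span N.+1 (fun t => f t * cosk 1 t).
Proof.
move=> [b fb]; rewrite (_ : (fun t => _) = fun t => \sum_(k < N)
    b k * cos_norm k * 2^-1 * (cosk (k + 1) t + cosk ((k - 1) + (1 - k)) t)).
  apply: cos_span_sum => k; apply: cos_spanZ; apply: cos_spanD.
    by apply: cos_span_cosk; rewrite addn1 ltnS.
  by apply: cos_span_cosk; have := ltn_ord k; lia.
apply/funext => t; rewrite fb mulr_suml; apply: eq_bigr => k _.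
by rewrite cons_basisE -!mulrA coskM.
Qed.

Lemma cos_span_exp_cosk1 i : cos_span i.+1 (fun t => cosk 1 t ^+ i).
Proof.
elim: i => [|i IH].
  rewrite (_ : (fun t => _) = cosk 0); first exact: cos_span_cosk.
  by apply/funext => t; rewrite cosk0.
under eq_fun do rewrite exprSr; exact: cos_span_mul_cosk1.
Qed.

Lemma cos_span_horner_cosk1 N (Q : {poly R}) : (size Q <= N)%N ->
  cos_span N (fun t => Q.[cosk 1 t]).
Proof.
move=> QN; under eq_fun do rewrite horner_coef.
apply: cos_span_sum => i; apply: cos_spanZ.
apply: cos_span_widen (cos_span_exp_cosk1 i).
exact: leq_trans QN.
Qed.

End CosineSystem.

(** * Completeness of the cosine system *)

Section KuhnPolynomials.
Context {R : realType}.

Lemma bernoulli_ineq (x : R) n : -1 <= x -> 1 + n%:R * x <= (1 + x) ^+ n.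
Proof.
move=> x1; elim: n => [|n IH]; first by rewrite mul0r addr0 expr0.
have x0 : 0 <= 1 + x by rewrite addrC -[1]opprK subr_ge0.
rewrite exprS (le_trans _ (ler_wpM2l x0 IH))//.
have -> : (1 + x) * (1 + n%:R * x) = 1 + n.+1%:R * x + n%:R * x ^+ 2.
  by rewrite -natr1; ring.
by rewrite lerDl mulr_ge0// sqr_ge0.
Qed.

(* Kuhn's polynomials, from his proof of the Weierstrass theorem: on [0, 1] they
   converge boundedly to the indicator of [0, 1/2) except at 1/2. *)
Definition kuhn n : {poly R} := (1 - 'X^n) ^+ (2 ^ n).

Lemma horner_kuhn n y : (kuhn n).[y] = (1 - y ^+ n) ^+ (2 ^ n).
Proof. by rewrite horner_exp !hornerE. Qed.

Lemma kuhn_unit_interval n y : 0 <= y <= 1 -> 0 <= (kuhn n).[y] <= 1.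
Proof.
move=> /andP[y0 y1].
have /andP[z0 z1] : 0 <= 1 - y ^+ n <= 1.
  by rewrite subr_ge0 exprn_ile1//= lerBlDr lerDl exprn_ge0.
by rewrite horner_kuhn exprn_ge0//= exprn_ile1.
Qed.

Lemma kuhn_cvg1 y : 0 <= y < 2^-1 -> (kuhn n).[y] @[n --> \oo] --> (1 : R).
Proof.
move=> /andP[y0 y2].
have y1 : y <= 1.
  by apply: ltW; apply: (lt_le_trans y2); rewrite invf_le1// ler1n.
have lower : 1 - (2 * y) ^+ n @[n --> \oo] --> (1 : R).
  rewrite -[X in _ --> X]subr0; apply: cvgB; first exact: cvg_cst.
  apply: cvg_expr; rewrite ger0_norm ?mulr_ge0//.
  by rewrite -ltr_pdivlMl// mulr1.
apply: (@squeeze_cvgr _ _ _ _ (fun n => 1 - (2 * y) ^+ n) (cst 1)) => //.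
  apply: nearW => n.
  have /andP[_ ->] := kuhn_unit_interval n (introT andP (conj y0 y1)).
  rewrite andbT horner_kuhn.
  apply: (le_trans _ (@bernoulli_ineq (- y ^+ n) (2 ^ n) _)).
    by rewrite mulrN exprMn natrX.
  by rewrite lerN2 exprn_ile1.
exact: cvg_cst.
Qed.

Lemma kuhn_cvg0 y : 2^-1 < y <= 1 -> (kuhn n).[y] @[n --> \oo] --> (0 : R).
Proof.
move=> /andP[y2 y1]; have y0 : 0 < y by apply: lt_trans y2.
have y2' : 1 < 2 * y by rewrite -ltr_pdivrMl// mulr1.
have y20 : 0 < 2 * y by rewrite mulr_gt0.
have kuhn0 n : 0 <= (kuhn n).[y].
  by have /andP[] := kuhn_unit_interval n (introT andP (conj (ltW y0) y1)).
have upper : (2 * y)^-1 ^+ n @[n --> \oo] --> (0 : R).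
  by apply: cvg_expr; rewrite ger0_norm ?invr_ge0 ?(ltW y20)// invf_lt1.
apply: (@squeeze_cvgr _ _ _ _ (cst 0) (fun n => (2 * y)^-1 ^+ n)) => //;
  [|exact: cvg_cst].
apply: nearW => n; rewrite kuhn0/=.
have yn0 : 0 < y ^+ n by rewrite exprn_gt0.
have kuhnM : (kuhn n).[y] * (1 + y ^+ n) ^+ (2 ^ n) <= 1.
  rewrite horner_kuhn -exprMn.
  rewrite (_ : (1 - y ^+ n) * (1 + y ^+ n) = 1 - (y ^+ n) ^+ 2); last by ring.
  have yn1 : (y ^+ n) ^+ 2 <= 1 by rewrite -exprM exprn_ile1// ltW.
  by rewrite exprn_ile1// ?subr_ge0// lerBlDr lerDl sqr_ge0.
have le_bernoulli : (2 * y) ^+ n <= (1 + y ^+ n) ^+ (2 ^ n).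
  apply: le_trans (@bernoulli_ineq (y ^+ n) (2 ^ n) _).
    by rewrite exprMn natrX lerDr.
  by rewrite (le_trans _ (ltW yn0))// lerN10.
rewrite exprVn -[leRHS]mul1r ler_pdivlMr ?exprn_gt0//.
by apply: (le_trans _ kuhnM); rewrite ler_wpM2l.
Qed.

End KuhnPolynomials.

Section CosineApproximation.
Context {R : realType} (T : R).
Hypothesis T0 : 0 < T.
Notation mu := (@lebesgue_measure R).
Notation D := (`[0, T] : set R).
Implicit Types (u v f g : R -> R) (Q : {poly R}).

Let mD : measurable (D : set (measurableTypeR R)).
Proof. exact: measurable_itv. Qed.

Definition sqdist u v := \int[mu]_(t in D) (u t - v t) ^+ 2.

Lemma sqdist_ge0 u v : 0 <= sqdist u v.
Proof. by apply: Rintegral_ge0 => t _; exact: sqr_ge0. Qed.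

Lemma sqdistxx u : sqdist u u = 0.
Proof.
rewrite /sqdist; under eq_Rintegral do rewrite subrr expr0n/=.
by rewrite Rintegral_cst// mul0r.
Qed.

Lemma eq_sqdist u v f : {in D, u =1 v} -> sqdist u f = sqdist v f.
Proof. by move=> uv; apply: eq_Rintegral => t /uv ->. Qed.

Lemma sqdistZ u v c : inL2 T u -> inL2 T v ->
  sqdist (fun t => c * u t) (fun t => c * v t) = c ^+ 2 * sqdist u v.
Proof.
move=> Lu Lv; have [_ iuv] := inL2B Lu Lv.
by rewrite -RintegralZl//; apply: eq_Rintegral => t _; rewrite -mulrBr exprMn.
Qed.

Lemma sqdistD u v f g : inL2 T u -> inL2 T v -> inL2 T f -> inL2 T g ->
  sqdist (fun t => u t + v t) (fun t => f t + g t) <=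
    2 * sqdist u f + 2 * sqdist v g.
Proof.
move=> Lu Lv Lf Lg.
have [_ iuvfg] := inL2B (inL2D Lu Lv) (inL2D Lf Lg).
have [_ iuf] := inL2B Lu Lf; have [_ ivg] := inL2B Lv Lg.
rewrite -!RintegralZl// -RintegralD//; [|exact: integrableZ_EFin..].
apply: le_Rintegral => //.
  by apply: integrableD_EFin => //; exact: integrableZ_EFin.
move=> t _; rewrite (_ : _ - _ = u t - f t - (g t - v t)); last by ring.
by rewrite (le_trans (sqrB_le _ _))// -[(g t - v t) ^+ 2]sqrrN opprB.
Qed.

Lemma sqdist_triangle u v f : inL2 T u -> inL2 T v -> inL2 T f ->
  sqdist u f <= 2 * sqdist u v + 2 * sqdist v f.
Proof.
move=> Lu Lv Lf; apply: le_trans (sqdistD Lu Lv Lv Lf).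
rewrite le_eqVlt; apply/orP; left; apply/eqP/eq_Rintegral => t _.
by congr (_ ^+ 2); ring.
Qed.

Lemma sqdist_cvg0 u (v_ : nat -> R -> R) h :
  measurable_fun D u -> (forall n, measurable_fun D (v_ n)) ->
  {ae mu, forall t, D t -> v_ n t @[n --> \oo] --> u t} ->
  mu.-integrable D (EFin \o h) ->
  (forall n t, D t -> (u t - v_ n t) ^+ 2 <= h t) ->
  sqdist u (v_ n) @[n --> \oo] --> 0.
Proof.
move=> meas_u mv vu ih uvh; exact: (Rdominated_cvg_sqrB mD meas_u mv vu ih uvh).
Qed.

Definition cos_approx u :=
  forall e, 0 < e -> exists Q, sqdist u (fun t => Q.[cosk T 1 t]) <= e.

Lemma inL2_horner_cosk1 Q : inL2 T (fun t => Q.[cosk T 1 t]).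
Proof.
have [b /funext ->] := cos_span_horner_cosk1 T0 (leqnn (size Q)).
exact: (inL2_continuous T0 (@continuous_cos_poly _ T _ b)).
Qed.

Lemma cos_approx_horner_cosk1 Q : cos_approx (fun t => Q.[cosk T 1 t]).
Proof. by move=> e e0; exists Q; rewrite sqdistxx ltW. Qed.

Lemma cos_approx_cst c : cos_approx (fun=> c).
Proof.
have := cos_approx_horner_cosk1 c%:P; congr cos_approx.
by apply/funext => t; rewrite hornerC.
Qed.

Lemma eq_cos_approx u v : {in D, u =1 v} -> cos_approx u -> cos_approx v.
Proof.
by move=> uv au e /au[Q uQ]; exists Q; rewrite -(eq_sqdist _ uv).
Qed.

Lemma cos_approx_limit u : inL2 T u ->
  (forall e, 0 < e ->
     exists v, [/\ inL2 T v, cos_approx v & sqdist u v <= e]) ->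
  cos_approx u.
Proof.
move=> Lu h e e0; have e40 : 0 < e / 4 by rewrite divr_gt0.
have [v [Lv av uv]] := h _ e40; have [Q vQ] := av _ e40; exists Q.
rewrite (le_trans (sqdist_triangle Lu Lv (inL2_horner_cosk1 Q)))//.
by move: uv vQ; lra.
Qed.

Lemma cos_approx_dominated_limit u (v_ : nat -> R -> R) h : inL2 T u ->
  (forall n, inL2 T (v_ n)) -> (forall n, cos_approx (v_ n)) ->
  {ae mu, forall t, D t -> v_ n t @[n --> \oo] --> u t} ->
  mu.-integrable D (EFin \o h) ->
  (forall n t, D t -> (u t - v_ n t) ^+ 2 <= h t) ->
  cos_approx u.
Proof.
move=> Lu Lv av vu ih uvh; apply: cos_approx_limit => // e e0.
have mv n : measurable_fun D (v_ n) by have [] := Lv n.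
have /cvgrPdist_le/(_ _ e0)[n _ /(_ n (leqnn n))] :=
  sqdist_cvg0 Lu.1 mv vu ih uvh.
by rewrite /= sub0r normrN (ger0_norm (sqdist_ge0 _ _)); exists (v_ n).
Qed.

Lemma cos_approxD u v : inL2 T u -> inL2 T v -> cos_approx u -> cos_approx v ->
  cos_approx (fun t => u t + v t).
Proof.
move=> Lu Lv au av e e0; have e40 : 0 < e / 4 by rewrite divr_gt0.
have [Q uQ] := au _ e40; have [S vS] := av _ e40; exists (Q + S).
under [X in sqdist _ X]eq_fun do rewrite hornerD.
have := sqdistD Lu Lv (inL2_horner_cosk1 Q) (inL2_horner_cosk1 S).
by move: uQ vS; lra.
Qed.

Lemma cos_approxZ u c : inL2 T u -> cos_approx u ->
  cos_approx (fun t => c * u t).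
Proof.
move=> Lu au e e0; have c0 : 0 < c ^+ 2 + 1 by rewrite ltr_wpDl// sqr_ge0.
have [|Q uQ] := au (e / (c ^+ 2 + 1)); first by rewrite divr_gt0.
exists (c *: Q); under [X in sqdist _ X]eq_fun do rewrite hornerZ.
rewrite sqdistZ//; last exact: inL2_horner_cosk1.
apply: (@le_trans _ _ (c ^+ 2 * (e / (c ^+ 2 + 1)))).
  by rewrite ler_wpM2l// sqr_ge0.
by rewrite mulrA ler_pdivrMr// mulrC ler_wpM2l ?(ltW e0)// lerDl.
Qed.

Lemma cos_approxB u v : inL2 T u -> inL2 T v -> cos_approx u -> cos_approx v ->
  cos_approx (fun t => u t - v t).
Proof.
move=> Lu Lv au av.
have := cos_approxD Lu (inL2Z (-1) Lv) au (cos_approxZ (-1) Lv av).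
by congr cos_approx; apply/funext => t; rewrite mulN1r.
Qed.

Lemma cos_approx_sum (I : Type) (r : seq I) (F : I -> R -> R) :
  (forall i, inL2 T (F i)) -> (forall i, cos_approx (F i)) ->
  cos_approx (fun t => \sum_(i <- r) F i t).
Proof.
move=> LF aF; elim: r => [|i r IH].
  by under eq_fun do rewrite big_nil; exact: cos_approx_cst.
by under eq_fun do rewrite big_cons; apply: cos_approxD => //; exact: inL2_sum.
Qed.

End CosineApproximation.

Section CosineCompleteness.
Context {R : realType} (T : R).
Hypothesis T0 : 0 < T.
Notation mu := (@lebesgue_measure R).
Notation D := (`[0, T] : set R).
Implicit Types (u v : R -> R) (Q : {poly R}).

Lemma cosk1_decreasing s t : 0 <= s -> s < t -> t <= T ->
  cosk T 1 t < cosk T 1 s.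
Proof.
have angle r : 0 <= r <= T -> 1%:R * pi * r / T \in `[0, pi]%R.
  move=> /andP[r0 rT].
  rewrite in_itv/= mul1r divr_ge0 ?mulr_ge0 ?pi_ge0 ?(ltW T0)//=.
  by rewrite ler_pdivrMr// ler_wpM2l// pi_ge0.
move=> s0 st tT; have sT := le_trans (ltW st) tT.
have t0 := le_trans s0 (ltW st).
rewrite /cosk ltr_cos ?angle ?s0 ?t0//.
by rewrite ltr_pM2r ?invr_gt0// ltr_pM2l// mul1r pi_gt0.
Qed.

(* An affine function of [cos (pi t / T)] with values in [0, 1] that crosses 1/2
   at [t = s] only. *)
Definition ray_threshold s : {poly R} :=
  (2^-1 + cosk T 1 s / 4)%:P - 4^-1 *: 'X.

Lemma horner_ray_threshold s t :
  (ray_threshold s).[cosk T 1 t] = 2^-1 + (cosk T 1 s - cosk T 1 t) / 4.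
Proof. by rewrite !hornerE; ring. Qed.

Lemma kuhn_ray_threshold_cvg s t : 0 <= s <= T -> 0 <= t <= T -> t != s ->
  (kuhn n \Po ray_threshold s).[cosk T 1 t] @[n --> \oo]
  --> (\1_(`]-oo, s[%classic) t : R).
Proof.
move=> /andP[s0 sT] /andP[t0 tT] ts.
pose y := 2^-1 + (cosk T 1 s - cosk T 1 t) / 4.
under eq_fun do rewrite horner_comp horner_ray_threshold -/y.
have := cosk_bounded T 1 s; have := cosk_bounded T 1 t => cost coss.
move: ts; rewrite neq_lt => /orP[ts|st].
  rewrite indicE mem_set/=; last by rewrite in_itv.
  apply: kuhn_cvg1; have := cosk1_decreasing t0 ts sT.
  by rewrite /y; move: cost coss => /andP[? ?] /andP[? ?]; lra.
rewrite indicE memNset/=; last first.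
  by rewrite in_itv/=; apply/negP; rewrite -leNgt ltW.
apply: kuhn_cvg0; have := cosk1_decreasing s0 st tT.
by rewrite /y; move: cost coss => /andP[? ?] /andP[? ?]; lra.
Qed.

Lemma sqrB_unit_interval (a b : R) : 0 <= a <= 1 -> 0 <= b <= 1 ->
  (a - b) ^+ 2 <= 1.
Proof. by move=> /andP[a0 a1] /andP[b0 b1]; nra. Qed.

Lemma indic_unit_interval (A : set R) t : 0 <= (\1_A t : R) <= 1.
Proof. by rewrite indicE; case: (_ \in _); rewrite ?lexx ?ler01. Qed.

Lemma cos_approx_indic_ray s : cos_approx T (\1_(`]-oo, s[%classic) : R -> R).
Proof.
have cst_on_D c : (forall t, D t -> \1_(`]-oo, s[%classic) t = c :> R) ->
    cos_approx T (\1_(`]-oo, s[%classic) : R -> R).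
  move=> indc; apply: eq_cos_approx (@cos_approx_cst _ T c) => t /set_mem Dt.
  by rewrite indc.
have [s0|s0] := leP s 0.
  apply: (cst_on_D 0) => t; rewrite /= in_itv/= => /andP[t0 _].
  rewrite indicE memNset//= in_itv/=; apply/negP.
  by rewrite -leNgt (le_trans s0).
have [sT|Ts] := leP s T; last first.
  apply: (cst_on_D 1) => t; rewrite /= in_itv/= => /andP[_ tT].
  by rewrite indicE mem_set//= in_itv/= (le_lt_trans tT).
have sD : 0 <= s <= T by rewrite sT ltW.
apply: (@cos_approx_dominated_limit _ _ T0 _
  (fun n t => (kuhn n \Po ray_threshold s).[cosk T 1 t]) (cst 1)).
- by apply: inL2_indic.
- by move=> n; exact: inL2_horner_cosk1.
- by move=> n; exact: cos_approx_horner_cosk1.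
- exists [set s]; split; [exact: measurable_set1|exact: lebesgue_measure_set1|].
  move=> t /= not_cvg; apply: contrapT => ts; apply: not_cvg => tD.
  by apply: kuhn_ray_threshold_cvg => //; exact/eqP.
- exact: integrable_cst_segment.
- move=> n t _; apply: sqrB_unit_interval; first exact: indic_unit_interval.
  rewrite horner_comp horner_ray_threshold; apply: kuhn_unit_interval.
  have /andP[? ?] := cosk_bounded T 1 s; have /andP[? ?] := cosk_bounded T 1 t.
  by lra.
Qed.

Lemma cvg_indic_bigcup (F : (set R)^nat) t : nondecreasing_seq F ->
  \1_(F n) t @[n --> \oo] --> (\1_(\bigcup_n F n) t : R).
Proof.
move=> ndF; apply: cvg_near_cst.
have [[N _ FNt]|nF] := pselect ((\bigcup_n F n) t).
  exists N => // n /= Nn.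
  have Fnt : F n t by have /subsetPset := ndF _ _ Nn; exact.
  by rewrite !indicE !mem_set//; exists N.
by apply: nearW => n; rewrite !indicE !memNset// => Fnt; apply: nF; exists n.
Qed.

Lemma cos_approx_indic (A : set R) : measurable A ->
  cos_approx T (\1_A : R -> R).
Proof.
pose approximable :=
  [set B : set R | measurable B /\ cos_approx T (\1_B : R -> R)].
have sigma_rays : @measurable _ (measurableTypeR R) = <<s @RGenInftyO.G R >>.
  exact: RGenInftyO.measurableE.
have rays_setI : setI_closed (@RGenInftyO.G R).
  move=> _ _ [a ->] [b ->]; exists (Num.min a b).
  apply/seteqP; split => x /=; rewrite !in_itv/= lt_min.
    by move=> [-> ->].
  by move=> /andP[].
have lambda_approximable : lambda_system setT approximable.
  split=> //.
  - by split=> //; rewrite indicT; exact: cos_approx_cst.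
  - move=> B C CB [mB aB] [mC aC]; split; first exact: measurableD.
    rewrite (_ : \1__ = fun t => \1_B t - \1_C t).
      by apply: cos_approxB => //; exact: inL2_indic.
    apply/funext => t; rewrite !indicE in_setD.
    have [Ct|_] := boolP (t \in C); last by rewrite andbT subr0.
    by rewrite andbF (mem_set (CB t (set_mem Ct))) subrr.
  - move=> F ndF aF; have mF n : measurable (F n) by have [] := aF n.
    split; first exact: bigcupT_measurable.
    apply: (@cos_approx_dominated_limit _ _ T0 _ (fun n => \1_(F n)) (cst 1)).
    + by apply: inL2_indic => //; exact: bigcupT_measurable.
    + by move=> n; exact: inL2_indic.
    + by move=> n; have [] := aF n.
    + by apply: aeW => t _; exact: cvg_indic_bigcup.
    + exact: integrable_cst_segment.
    + by move=> n t _; apply: sqrB_unit_interval; exact: indic_unit_interval.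
have rays_approximable : @RGenInftyO.G R `<=` approximable.
  by move=> _ [a ->]; split=> //; exact: cos_approx_indic_ray.
move=> mA; have {}mA : <<s @RGenInftyO.G R >> A by rewrite -sigma_rays.
by have [] := lambda_system_subset rays_setI lambda_approximable
  rays_approximable (fun X _ => @subsetT _ X) mA.
Qed.

Import HBSimple HBNNSimple.

Lemma cos_approx_nnsfun (f : {nnsfun R >-> R}) : cos_approx T f.
Proof.
pose s : seq R := finmap.enum_fset (fset_set (range f)).
have -> : f = (fun t => \sum_(y <- s) y * \1_(f @^-1` [set y]) t) :> (R -> R).
  apply/funext => t.
  rewrite -(@fsbig_finite _ _ _ _ (range f)
    (fun y => y * \1_(f @^-1` [set y]) t))//.
  exact: (fimfunE f).
have mf y : measurable ((f : R -> R) @^-1` [set y]) by exact: measurable_sfunP.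
have Lf y : inL2 T (\1_(f @^-1` [set y]) : R -> R) by exact: inL2_indic (mf y).
apply: cos_approx_sum => // y; first exact: inL2Z.
by apply: cos_approxZ => //; exact: cos_approx_indic.
Qed.

Lemma cos_approx_ge0 u : measurable_fun setT u -> (forall t, 0 <= u t) ->
  inL2 T u -> cos_approx T u.
Proof.
move=> meas_u u0 Lu.
have mEu : measurable_fun setT (EFin \o u) by exact/measurable_EFinP.
pose f n : {nnsfun R >-> R} := nnsfun_approx measurableT mEu n.
have fu t : f n t @[n --> \oo] --> u t.
  have /fine_cvg : (f n t)%:E @[n --> \oo] --> (u t)%:E.
    by apply: (cvg_nnsfun_approx measurableT mEu) => // y _; rewrite lee_fin.
  exact.
have f_le n t : f n t <= u t.
  rewrite -(cvg_lim _ (fu t))//; apply: nondecreasing_cvgn_le.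
    by move=> a b ab; have /lefP := nd_nnsfun_approx measurableT mEu ab; exact.
  by apply/cvg_ex; exists (u t).
have Lf n : inL2 T (f n).
  apply: le_inL2 Lu; first exact: measurable_funTS.
  by move=> t _; rewrite !ger0_norm.
apply: (@cos_approx_dominated_limit _ _ T0 _ (fun n => f n)
  (fun t => u t ^+ 2)) => //.
- by move=> n; exact: cos_approx_nnsfun.
- by apply: aeW => t _; exact: fu.
- by case: Lu.
- by move=> n t _; rewrite lerXn2r ?nnegrE ?subr_ge0// lerBlDr lerDl.
Qed.

Lemma inL2_cos_approx u : inL2 T u -> cos_approx T u.
Proof.
move=> Lu; pose u' : R -> R := u \_ D.
have mu' : measurable_fun setT u'.
  by apply/(measurable_restrictT _ _).1 => //; case: Lu.
have u'E : {in D, u' =1 u} by move=> t tD; rewrite /u' patchE tD.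
have le_u (w : R -> R) : measurable_fun setT w ->
    (forall t, `|w t| <= `|u' t|) -> inL2 T w.
  move=> mw wu; apply: le_inL2 Lu; first exact: measurable_funTS.
  by move=> t Dt; rewrite -(u'E t) ?inE.
have mpos := measurable_funrpos mu'; have mneg := measurable_funrneg mu'.
have Lpos : inL2 T u'^\+.
  apply: le_u => // t; rewrite ger0_norm ?funrpos_ge0// /funrpos.
  by rewrite ge_max ler_norm normr_ge0.
have Lneg : inL2 T u'^\-.
  apply: le_u => // t; rewrite ger0_norm ?funrneg_ge0// /funrneg.
  by rewrite ge_max -normrN ler_norm normr_ge0.
apply: (eq_cos_approx u'E); rewrite -[u']funrposBneg.
by apply: cos_approxB => //; apply: cos_approx_ge0.
Qed.

Lemma sqdist_cos_poly u N b : inL2 T u ->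
  sqdist T u (cos_poly T N b) = L2ip T u u -
    \sum_(k < N) L2ip T u (cons_basis T k) ^+ 2 +
    \sum_(k < N) (L2ip T u (cons_basis T k) - b k) ^+ 2.
Proof.
move=> Lu; have Lp : inL2 T (cos_poly T N b).
  exact/(inL2_continuous T0)/continuous_cos_poly.
have Lbasis (k : 'I_N) : inL2 T (cons_basis T k).
  exact/(inL2_continuous T0)/continuous_cons_basis.
have iuu := integrable_inL2M Lu Lu; have iup := integrable_inL2M Lu Lp.
have ipp := integrable_inL2M Lp Lp.
have -> : sqdist T u (cos_poly T N b) =
    L2ip T u u + - 2 * L2ip T u (cos_poly T N b) +
    L2ip T (cos_poly T N b) (cos_poly T N b).
  rewrite /L2ip /sqdist -RintegralZl//.
  rewrite -RintegralD//; last exact: integrableZ_EFin.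
  rewrite -RintegralD//; last first.
    by apply: integrableD_EFin => //; exact: integrableZ_EFin.
  by apply: eq_Rintegral => t _; ring.
rewrite L2ip_cos_poly// L2ipC (L2ip_suml _ (fun k : 'I_N => b k) Lbasis Lu).
rewrite -!addrA; congr (_ + _); rewrite mulr_sumr -sumrN -!big_split/=.
by apply: eq_bigr => k _; rewrite (L2ipC T (cons_basis T k)); ring.
Qed.

Lemma bessel_inequality u N : inL2 T u ->
  \sum_(k < N) L2ip T u (cons_basis T k) ^+ 2 <= L2ip T u u.
Proof.
move=> Lu; rewrite -subr_ge0.
have := sqdist_cos_poly N (fun k => L2ip T u (cons_basis T k)) Lu.
rewrite [X in _ = _ + X]big1 ?addr0; last by move=> k _; rewrite subrr expr0n.
by move=> <-; exact: sqdist_ge0.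
Qed.

Lemma parseval u : inL2 T u ->
  \sum_(k < N) L2ip T u (cons_basis T k) ^+ 2 @[N --> \oo] --> L2ip T u u.
Proof.
move=> Lu; apply/cvgrPdist_le => e e0.
have [Q uQ] := inL2_cos_approx Lu e0; exists (size Q) => // N /= QN.
have [b /funext Qb] := cos_span_horner_cosk1 T0 QN.
rewrite ger0_norm ?subr_ge0 ?bessel_inequality//.
apply: le_trans uQ; rewrite Qb sqdist_cos_poly// lerDl.
by apply: sumr_ge0 => k _; rewrite sqr_ge0.
Qed.

End CosineCompleteness.

(** * Almost sure convergence *)

Section MaximalInequality.
Context d (T : measurableType d) (R : realType) (P : probability T R).
Variables (S : nat -> T -> R) (v : nat -> R) (K : R).
Hypothesis mS : forall n, measurable_fun setT (S n).
Hypothesis v0 : forall k, 0 <= v k.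
Hypothesis K0 : 0 <= K.

Let V a b := \sum_(a <= k < b) v k.

Hypothesis integrable_fourth_increment : forall a b, (a <= b)%N ->
  P.-integrable setT (EFin \o (fun w => (S b w - S a w) ^+ 4)).
Hypothesis fourth_increment_le : forall a b, (a <= b)%N ->
  \int[P]_w ((S b w - S a w) ^+ 4) <= K * V a b ^+ 2.

Let V_ge0 a b : 0 <= V a b. Proof. exact: sumr_ge0. Qed.

Let V_cat a h b : (a <= h)%N -> (h <= b)%N -> V a b = V a h + V h b.
Proof. exact: big_cat_nat. Qed.

Definition max_dev a b w :=
  \big[Num.max/0]_(a <= j < b.+1) (S j w - S a w) ^+ 4.

Lemma max_dev_ge0 a b w : 0 <= max_dev a b w.
Proof. exact: bigmax_ge_id. Qed.

Lemma le_max_dev a j b w : (a <= j <= b)%N ->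
  (S j w - S a w) ^+ 4 <= max_dev a b w.
Proof.
move=> ajb; pose dev i := (S i w - S a w) ^+ 4.
by apply: (le_bigmax_seq 0 j xpredT dev) => //; rewrite mem_index_iota ltnS.
Qed.

Lemma max_dev_le a b w M : 0 <= M ->
  (forall j, (a <= j <= b)%N -> (S j w - S a w) ^+ 4 <= M) ->
  max_dev a b w <= M.
Proof.
move=> M0 leM; rewrite /max_dev big_seq_cond; apply: bigmax_le => // j.
by rewrite andbT mem_index_iota ltnS; exact: leM.
Qed.

Lemma max_dev_mono a w :
  {homo (fun b => max_dev a b w) : b c / (b <= c)%N >-> b <= c}.
Proof.
move=> b c bc; apply: max_dev_le => [|j /andP[aj jb]]; first exact: max_dev_ge0.
by apply: le_max_dev; rewrite aj (leq_trans jb).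
Qed.

Lemma measurable_max_dev a b : measurable_fun setT (max_dev a b).
Proof.
rewrite /max_dev; elim: (index_iota a b.+1) => [|j s IH].
  by under eq_fun do rewrite big_nil; exact: measurable_cst.
under eq_fun do rewrite big_cons; apply: measurable_maxr => //.
exact/measurable_funX/measurable_funB.
Qed.

Lemma integrable_max_dev a b : P.-integrable setT (EFin \o max_dev a b).
Proof.
apply: (@le_integrable_EFin _ _ _ P _ measurableT _
  (fun w => \sum_(j < b.+1) (S (maxn a j) w - S a w) ^+ 4)).
- exact: measurable_max_dev.
- move=> w _; rewrite ger0_norm ?max_dev_ge0//; apply: max_dev_le => [|j].
    by apply: sumr_ge0 => j _; rewrite exprn_even_ge0.
  move=> /andP[aj]; rewrite -ltnS => jb.
  rewrite (bigD1 (Ordinal jb))//= (maxn_idPr aj) lerDl sumr_ge0// => i _.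
  by rewrite exprn_even_ge0.
- apply: (@integrable_sum_EFin _ _ _ _ _ measurableT) => j.
  exact/integrable_fourth_increment/leq_maxl.
Qed.

(* The constant 3/2 < 2 is what makes the induction below contract. *)
Lemma fourth_powerD_le (x y : R) :
  (x + y) ^+ 4 <= 3 / 2 * y ^+ 4 + 512 * x ^+ 4.
Proof.
have sqrD_le (p q : R) : (p + q) ^+ 2 <= 8 / 7 * q ^+ 2 + 8 * p ^+ 2.
  rewrite -subr_ge0 (_ : _ - _ = 7^-1 * (q - 7 * p) ^+ 2); last by field.
  by rewrite mulr_ge0// sqr_ge0.
have x2 := sqr_ge0 x; have y2 := sqr_ge0 y.
apply: (@le_trans _ _ ((8 / 7 * y ^+ 2 + 8 * x ^+ 2) ^+ 2)).
  rewrite (exprM _ 2 2) lerXn2r ?nnegrE ?sqr_ge0//.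
  by rewrite addr_ge0// mulr_ge0// ?divr_ge0.
rewrite addrC; apply: (le_trans (sqrD_le _ _)).
rewrite (exprM y 2 2) (exprM x 2 2); have := sqr_ge0 (y ^+ 2).
by have := sqr_ge0 (x ^+ 2); nra.
Qed.

Lemma max_dev_split a h b w : (a <= h)%N -> (h < b)%N ->
  max_dev a b w <= 3 / 2 * (max_dev a h w + max_dev h.+1 b w) +
                   512 * (S h.+1 w - S a w) ^+ 4.
Proof.
move=> ah hb; have D1 := max_dev_ge0 a h w; have D2 := max_dev_ge0 h.+1 b w.
have Q0 : 0 <= (S h.+1 w - S a w) ^+ 4 by rewrite exprn_even_ge0.
apply: max_dev_le => [|j /andP[aj jb]]; first by lra.
have [jh|hj] := leqP j h.
  by have := @le_max_dev a j h w; rewrite aj jh => /(_ isT); lra.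
have -> : S j w - S a w = (S h.+1 w - S a w) + (S j w - S h.+1 w) by ring.
apply: (le_trans (fourth_powerD_le _ _)); rewrite lerD2r ler_wpM2l//.
by have := @le_max_dev h.+1 j b w; rewrite hj jb => /(_ isT); lra.
Qed.

Lemma half_split a b : (a < b)%N ->
  exists h, [/\ (a <= h < b)%N, V a h <= V a b / 2 & V h.+1 b <= V a b / 2].
Proof.
case: b => // b; rewrite ltnS => ab; have Vab := V_ge0 a b.+1.
have half : V a b.+1 / 2 <= V a b.+1 by lra.
have ex : exists h, (a <= h)%N && (V a b.+1 / 2 <= V a h.+1).
  by exists b; rewrite ab half.
case: (ex_minnP ex) => h /andP[ah Vh] hmin.
have hb : (h <= b)%N by apply: hmin; rewrite ab half.
exists h; split; first by rewrite ah.
- case: h ah {Vh hb} hmin => [|h] ah hmin.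
    by rewrite [leLHS]/V big_geq// divr_ge0.
  have [ah'|] := leqP a h; last first.
    by move=> ha; rewrite [leLHS]/V big_geq// divr_ge0.
  rewrite leNgt; apply/negP => /ltW Vh.
  by have := hmin h; rewrite ah' Vh ltnn => /(_ isT).
- by have := V_cat (leqW ah) (hb : h.+1 <= b.+1)%N; lra.
Qed.

Lemma Rintegral_max_dev_bound :
  exists2 A, 0 <= A & forall a b, \int[P]_w max_dev a b w <= A * V a b ^+ 2.
Proof.
have [A A0 contracts] : exists2 A, 0 <= A & 3 / 4 * A + 512 * K <= A.
  by exists (2048 * K); have := K0; lra.
exists A => // a b; have [n] := ubnP (b - a); elim: n a b => // n IH a b.
rewrite ltnS => ban; have [ba|ab] := leqP b a.
  have -> : max_dev a b = cst 0.
    apply/funext => w; apply/le_anti; rewrite max_dev_ge0 andbT.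
    apply: max_dev_le => // j /andP[aj jb].
    have -> : j = a by apply/eqP; rewrite eqn_leq aj (leq_trans jb).
    by rewrite subrr expr0n.
  by rewrite Rintegral_cst// mul0r mulr_ge0 ?sqr_ge0.
have [h [/andP[ah hb] Vah Vhb]] := half_split ab.
have half_block a' b' : (b' - a' < n)%N -> V a' b' <= V a b / 2 ->
    \int[P]_w max_dev a' b' w <= A / 4 * V a b ^+ 2.
  move=> /IH leIH V_le; apply: le_trans leIH _; rewrite -mulrA ler_wpM2l//.
  rewrite (_ : 4^-1 * _ = (V a b / 2) ^+ 2); last by field.
  by rewrite lerXn2r ?nnegrE ?divr_ge0.
have left_block := half_block a h ltac:(lia) Vah.
have right_block := half_block h.+1 b ltac:(lia) Vhb.
have increment : \int[P]_w ((S h.+1 w - S a w) ^+ 4) <= K * V a b ^+ 2.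
  apply: le_trans (fourth_increment_le (leqW ah)) _.
  by rewrite ler_wpM2l// lerXn2r ?nnegrE// (V_cat (leqW ah) hb) lerDl.
have iD := integrableD_EFin measurableT (integrable_max_dev a h)
  (integrable_max_dev h.+1 b).
have iD' := integrableZ_EFin measurableT (3 / 2) iD.
have iQ := integrable_fourth_increment (leqW ah).
have iQ' := integrableZ_EFin measurableT 512 iQ.
apply: (@le_trans _ _
  (3 / 2 * (\int[P]_w max_dev a h w + \int[P]_w max_dev h.+1 b w) +
   512 * \int[P]_w ((S h.+1 w - S a w) ^+ 4))).
  rewrite -RintegralD//; [|exact: integrable_max_dev|exact: integrable_max_dev].
  rewrite -!RintegralZl// -RintegralD//.
  apply: le_Rintegral;
    [by []|exact: integrable_max_dev|exact: integrableD_EFin|].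
  by move=> w _; exact: max_dev_split.
by have := ler_wpM2r (sqr_ge0 (V a b)) contracts; lra.
Qed.

Definition sup_dev a w : \bar R := limn (fun b => (max_dev a b w)%:E).

Lemma max_dev_le_sup a b w : ((max_dev a b w)%:E <= sup_dev a w)%E.
Proof.
have nd : nondecreasing_seq (fun n => (max_dev a n w)%:E).
  by move=> m n mn; rewrite lee_fin; exact: max_dev_mono.
rewrite /sup_dev (cvg_lim _ (ereal_nondecreasing_cvgn nd))//.
by apply: ereal_sup_ubound; exists b.
Qed.

Lemma sup_dev_ge0 a w : (0 <= sup_dev a w)%E.
Proof.
by apply: le_trans (max_dev_le_sup a a w); rewrite lee_fin max_dev_ge0.
Qed.

Lemma measurable_sup_dev a : measurable_fun setT (sup_dev a).
Proof.
apply: (emeasurable_fun_cvg (fun b w => (max_dev a b w)%:E)) => [b|w _].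
  by apply/measurable_EFinP; exact: measurable_max_dev.
apply: ereal_nondecreasing_is_cvgn => m n mn.
by rewrite lee_fin; exact: max_dev_mono.
Qed.

Lemma integral_sup_dev_bound : exists2 A, 0 <= A &
  forall a (t : R), (forall b, V a b <= t) ->
    (\int[P]_w sup_dev a w <= (A * t ^+ 2)%:E)%E.
Proof.
have [A A0 leA] := Rintegral_max_dev_bound; exists A => // a t Vt.
have mD b : measurable_fun setT (fun w => (max_dev a b w)%:E).
  by apply/measurable_EFinP; exact: measurable_max_dev.
have D0 b w : setT w -> (0 <= (max_dev a b w)%:E)%E.
  by rewrite lee_fin max_dev_ge0.
have nd w : setT w -> nondecreasing_seq (fun b => (max_dev a b w)%:E).
  by move=> _ m n mn; rewrite lee_fin; exact: max_dev_mono.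
rewrite /sup_dev monotone_convergence//; apply: lime_le.
  apply: ereal_nondecreasing_is_cvgn => m n mn; apply: ge0_le_integral => //.
  - by move=> w _; exact: D0.
  - by move=> w _; exact: nd.
apply: nearW => b.
rewrite -(EFin_Rintegral measurableT (integrable_max_dev a b)).
rewrite lee_fin; apply: le_trans (leA a b) _.
by rewrite ler_wpM2l// lerXn2r ?nnegrE ?(le_trans _ (Vt b)).
Qed.

Lemma cvg_of_inf_sup_dev w : ereal_inf [set sup_dev a w | a in setT] = 0%E ->
  cvgn (fun n => S n w).
Proof.
move=> inf0; apply/cauchy_cvgP/cauchy_exP => e e0.
have : (ereal_inf [set sup_dev a w | a in setT] < (e ^+ 4)%:E)%E.
  by rewrite inf0 lte_fin exprn_gt0.
move=> /ereal_inf_lt[_ [a _ <-] sup_lt]; exists (S a w), a => // n /= an.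
have : (((S n w - S a w) ^+ 4)%:E < (e ^+ 4)%:E)%E.
  apply: le_lt_trans sup_lt; apply: le_trans (max_dev_le_sup a n w).
  by rewrite lee_fin le_max_dev// an leqnn.
rewrite lte_fin -[ltLHS]ger0_norm ?exprn_even_ge0// normrX.
by rewrite ltr_pXn2r ?nnegrE ?(ltW e0)// distrC.
Qed.

Lemma ae_cvg_fourth_increments : cvgn (fun n => V 0 n) ->
  {ae P, forall w, cvgn (fun n => S n w)}.
Proof.
move=> cV; have [A A0 leA] := integral_sup_dev_bound.
pose inf_sup w := ereal_inf [set sup_dev a w | a in setT].
have infE : inf_sup = (fun w => einfs (sup_dev ^~ w) 0).
  apply/funext => w; congr ereal_inf; apply/seteqP.
  by split => x /= [a]; exists a.
have m_inf : measurable_fun setT inf_sup.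
  by rewrite infE; apply: measurable_fun_einfs => a; exact: measurable_sup_dev.
have inf_ge0 w : (0 <= inf_sup w)%E.
  by apply: le_ereal_inf_tmp => _ [a _ <-]; exact: sup_dev_ge0.
pose tail a := limn (fun n => V 0 n) - V 0 a.
have ndV : nondecreasing_seq (fun n => V 0 n).
  by move=> m n mn /=; rewrite (V_cat (leq0n m) mn) lerDl.
have V_tail a b : V a b <= tail a.
  rewrite lerBrDl; have [ab|/ltnW ba] := leqP a b.
    by rewrite -V_cat//; exact: nondecreasing_cvgn_le.
  by rewrite [V a b]big_geq// addr0; exact: nondecreasing_cvgn_le.
have inf_le a : (\int[P]_w inf_sup w <= (A * tail a ^+ 2)%:E)%E.
  apply: le_trans (leA _ _ (V_tail a)).
  apply: ge0_le_integral => //; first exact: measurable_sup_dev.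
  by move=> w _; apply: ereal_inf_lbound; exists a.
have tail0 : tail a @[a --> \oo] --> (0 : R).
  rewrite -(subrr (limn (fun n => V 0 n))).
  by apply: cvgB => //; exact: cvg_cst.
have int0 : (\int[P]_w inf_sup w = 0)%E.
  apply/eqP; rewrite eq_le integral_ge0// andbT.
  have bound0 : (A * tail a ^+ 2)%:E @[a --> \oo] --> (0 : \bar R).
    apply: cvg_EFin; first exact: nearW.
    have := cvgMl_tmp (a := A)
      (cvg_comp tail _ tail0 (@exprn_continuous _ 2 _)).
    by rewrite expr0n mulr0; apply.
  rewrite -(cvg_lim _ bound0)//; apply: lime_ge.
    by apply/cvg_ex; exists 0%E.
  exact: nearW.
have /(ae_eq_integral_abs _ measurableT m_inf) : (\int[P]_w `|inf_sup w| = 0)%E.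
  by rewrite -[RHS]int0; apply: eq_integral => w _; rewrite gee0_abs.
by apply: filterS => w /(_ I); exact: cvg_of_inf_sup_dev.
Qed.

End MaximalInequality.

Section GaussianSeries.
Context d (T : measurableType d) (R : realType) (P : probability T R).
Variable Z : nat -> T -> R.
Hypothesis gaussianZ : forall N (b : nat -> R), gaussian_moments P
  (\sum_(k < N) b k ^+ 2) (fun w => \sum_(k < N) b k * Z k w).

Lemma gaussian_moments_increment (c : nat -> R) a b : (a <= b)%N ->
  gaussian_moments P (\sum_(a <= k < b) c k ^+ 2)
    (fun w => \sum_(k < b) c k * Z k w - \sum_(k < a) c k * Z k w).
Proof.
move=> ab; have tailE (F : nat -> R) :
    \sum_(k < b) (if (a <= k)%N then F k else 0) = \sum_(a <= k < b) F k.
  by rewrite big_geq_mkord [RHS]big_mkcond.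
have := gaussianZ b (fun k => if (a <= k)%N then c k else 0).
congr (gaussian_moments P _ _).
  by rewrite -tailE; apply: eq_bigr => k _; case: ifP => // _; rewrite expr0n.
apply/funext => w; rewrite -!(big_mkord xpredT (fun k => c k * Z k w)).
rewrite (big_cat_nat (leq0n a) ab)/= addrAC subrr add0r -tailE.
by apply: eq_bigr => k _; case: ifP => // _; rewrite mul0r.
Qed.

Lemma ae_cvg_gaussian_series (c : nat -> R) :
  cvgn (fun N => \sum_(k < N) c k ^+ 2) ->
  {ae P, forall w, cvgn (fun N => \sum_(k < N) c k * Z k w)}.
Proof.
move=> cc; pose S N w := \sum_(k < N) c k * Z k w.
have increment a b : (a <= b)%N -> _ := @gaussian_moments_increment c a b.
apply: (@ae_cvg_fourth_increments _ _ _ _ S (fun k => c k ^+ 2) 3).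
- by move=> N; have [/measurable_all_moments] := gaussianZ N c.
- by move=> k; exact: sqr_ge0.
- by [].
- by move=> a b ab; apply: integrable_moment; have [] := increment a b ab.
- move=> a b ab; have [_ ->] := increment a b ab.
  rewrite (gauss_moment_even _ 2) ler_wpM2r ?sqr_ge0//.
  by rewrite /odd_dfact !big_ord_recl big_ord0.
- by under eq_fun do rewrite big_mkord.
Qed.

End GaussianSeries.

(** * Mixed moments *)

Section MixedMoments.
Context d (T : measurableType d) (R : realType) (P : probability T R).

Lemma horner_inj (p q : {poly R}) : (forall z, p.[z] = q.[z]) -> p = q.
Proof.
move=> pq; apply/eqP; rewrite -subr_eq0; apply/eqP.
apply: (@roots_geq_poly_eq0 _ _ [seq i%:R | i <- iota 0 (size (p - q))]).
- by apply/allP => x _; rewrite rootE hornerD hornerN pq subrr.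
- by rewrite map_inj_uniq ?iota_uniq// => i j /eqP; rewrite eqr_nat => /eqP.
- by rewrite size_map size_iota.
Qed.

(* Both sides of the hypothesis are polynomials in [z]; compare coefficients. *)
Lemma pencil_moments (A U V : T -> R) (c v : R) :
  all_moments P A -> all_moments P U -> all_moments P V ->
  (forall z N, \int[P]_w (A w * (V w + z * U w) ^+ N) =
               c * gauss_moment (z ^+ 2 + v) N) ->
  forall k m, \int[P]_w (A w * U w ^+ k * V w ^+ m) =
              c * gauss_moment 1 k * gauss_moment v m.
Proof.
move=> LA LU LV pencil k m; pose N := (k + m)%N.
pose E i := \int[P]_w (A w * U w ^+ i * V w ^+ (N - i)).
have iE i : P.-integrable setT
    (EFin \o (fun w => A w * U w ^+ i * V w ^+ (N - i))).
  apply: all_moments_int; apply: all_momentsM; last exact: all_momentsX.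
  by apply: all_momentsM => //; exact: all_momentsX.
pose lhs := \poly_(i < N.+1) ('C(N, i)%:R * E i).
pose rhs := \poly_(i < N.+1)
  ('C(N, i)%:R * (c * gauss_moment 1 i * gauss_moment v (N - i))).
have /polyP/(_ k) : lhs = rhs.
  apply: horner_inj => z; rewrite !horner_poly.
  transitivity (\int[P]_w (A w * (V w + z * U w) ^+ N)).
    transitivity (\int[P]_w (\sum_(i < N.+1) ('C(N, i)%:R * z ^+ i) *
        (A w * U w ^+ i * V w ^+ (N - i)))).
      rewrite Rintegral_sum//; last by move=> i; exact: integrableZ_EFin.
      by apply: eq_bigr => i _; rewrite RintegralZl// mulrAC.
    apply: eq_Rintegral => w _; rewrite exprDn mulr_sumr.
    by apply: eq_bigr => i _; rewrite -mulr_natl exprMn; ring.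
  rewrite pencil -[z ^+ 2]mulr1 -gauss_momentD mulr_sumr; apply: eq_bigr => i _.
  by rewrite gauss_momentZ; ring.
rewrite !coef_poly ltnS leq_addr.
have binN0 : 'C(N, k)%:R != 0 :> R by rewrite pnatr_eq0 -lt0n bin_gt0 leq_addr.
by move=> /(mulfI binN0); rewrite /E /N addKn.
Qed.

Definition gauss_mean (Q : {poly R}) :=
  \sum_(k < size Q) Q`_k * gauss_moment 1 k.

Lemma gauss_mean_poly n (E : nat -> R) :
  gauss_mean (\poly_(k < n) E k) = \sum_(k < n) E k * gauss_moment 1 k.
Proof.
rewrite /gauss_mean; set p := \poly_(k < n) E k.
rewrite (big_ord_widen n (fun k => p`_k * gauss_moment 1 k)) ?size_poly//.
rewrite big_mkcond; apply: eq_bigr => k _.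
have -> : E k = p`_k by rewrite coef_poly ltn_ord.
by case: ltnP => // /(nth_default 0) ->; rewrite mul0r.
Qed.

Lemma pencil_horner (A U V : T -> R) (c v : R) (Q : {poly R}) :
  all_moments P A -> all_moments P U -> all_moments P V ->
  (forall z N, \int[P]_w (A w * (V w + z * U w) ^+ N) =
               c * gauss_moment (z ^+ 2 + v) N) ->
  forall m, \int[P]_w (A w * Q.[U w] * V w ^+ m) =
            c * gauss_mean Q * gauss_moment v m.
Proof.
move=> LA LU LV pencil m.
transitivity (\int[P]_w
    (\sum_(k < size Q) Q`_k * (A w * U w ^+ k * V w ^+ m))).
  apply: eq_Rintegral => w _; rewrite horner_coef mulr_sumr mulr_suml.
  by apply: eq_bigr => k _; ring.
have iE k : P.-integrable setT (EFin \o (fun w => A w * U w ^+ k * V w ^+ m)).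
  apply: all_moments_int; apply: all_momentsM; last exact: all_momentsX.
  by apply: all_momentsM => //; exact: all_momentsX.
rewrite Rintegral_sum//; last by move=> k; exact: integrableZ_EFin.
rewrite mulr_sumr mulr_suml; apply: eq_bigr => k _.
by rewrite RintegralZl// (pencil_moments LA LU LV pencil); ring.
Qed.

Variables (n : nat) (W : 'I_n -> T -> R).
Hypothesis LW : forall j, all_moments P (W j).
Hypothesis gaussian_comb : forall t : 'I_n -> R,
  gaussian_moments P (\sum_j t j ^+ 2) (fun w => \sum_j t j * W j w).

(* The variables are split off one at a time. *)
Lemma Rintegral_prod_horner_comb (Q : 'I_n -> {poly R}) r : (r <= n)%N ->
  forall t m, \int[P]_w (\prod_(j < n | (j < r)%N) (Q j).[W j w] *
                         (\sum_(j < n | (r <= j)%N) t j * W j w) ^+ m) =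
    \prod_(j < n | (j < r)%N) gauss_mean (Q j) *
    gauss_moment (\sum_(j < n | (r <= j)%N) t j ^+ 2) m.
Proof.
elim: r => [|r IH] rn t m.
  rewrite big_pred0// mul1r -(gaussian_comb t).2.
  by apply: eq_Rintegral => w _; rewrite big_pred0// mul1r.
pose jr := Ordinal rn.
have jrE (j : 'I_n) : (j != jr) = (j != r :> nat) by [].
have prod_lt_r1 (F : 'I_n -> R) :
    \prod_(j < n | (j < r.+1)%N) F j = \prod_(j < n | (j < r)%N) F j * F jr.
  rewrite (bigD1 jr)//= mulrC; congr (_ * _); apply: eq_bigl => j.
  by rewrite jrE ltnS andbC -ltn_neqAle.
have sum_ge_r (F : 'I_n -> R) :
    \sum_(j < n | (r <= j)%N) F j = \sum_(j < n | (r < j)%N) F j + F jr.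
  rewrite (bigD1 jr)//= addrC; congr (_ + _); apply: eq_bigl => j.
  by rewrite jrE andbC eq_sym -ltn_neqAle.
pose head w := \prod_(j < n | (j < r)%N) (Q j).[W j w].
pose rest w := \sum_(j < n | (r < j)%N) t j * W j w.
have Lhead : all_moments P head.
  by apply: (@all_moments_prod _ _ _ P _ _ _ (fun j w => (Q j).[W j w])) => j;
    exact: all_moments_horner.
have Lrest : all_moments P rest.
  by apply: (@all_moments_sum _ _ _ P _ _ _ (fun j w => t j * W j w)) => j;
    exact: all_momentsZ.
under eq_Rintegral do rewrite prod_lt_r1.
rewrite prod_lt_r1; apply: (pencil_horner (Q jr) Lhead (LW jr) Lrest) => z N.
pose t' j := if j == jr then z else t j.
have t'_r : t' jr = z by rewrite /t' eqxx.
have t'_rest (F : R -> 'I_n -> R) :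
    \sum_(j < n | (r < j)%N) F (t' j) j = \sum_(j < n | (r < j)%N) F (t j) j.
  by apply: eq_bigr => j rj; rewrite /t' ifN// jrE gtn_eqF.
have := IH (ltnW rn) t' N.
rewrite sum_ge_r t'_r (t'_rest (fun x _ => x ^+ 2)) addrC => <-.
apply: eq_Rintegral => w _; congr (_ * _ ^+ _).
by rewrite sum_ge_r t'_r (t'_rest (fun x j => x * W j w)).
Qed.

Lemma Rintegral_prod_horner (Q : 'I_n -> {poly R}) :
  \int[P]_w (\prod_j (Q j).[W j w]) = \prod_j gauss_mean (Q j).
Proof.
have := Rintegral_prod_horner_comb Q (leqnn n) (fun=> 0) 0.
rewrite gauss_moment0 mulr1 (eq_bigl _ _ (@ltn_ord n)) => <-.
by apply: eq_Rintegral => w _; rewrite expr0 mulr1 (eq_bigl _ _ (@ltn_ord n)).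
Qed.

Lemma Rintegral_prod_even_powers (a : 'I_n -> R) (p : 'I_n -> nat) (b : R) :
  \int[P]_w (\prod_j (a j + b * W j w) ^+ (2 * p j)) =
  \prod_j \sum_(s < (p j).+1) ('C(2 * p j, 2 * s) * odd_dfact s)%:R *
    (b ^+ 2) ^+ s * a j ^+ (2 * p j - 2 * s).
Proof.
pose E j k := 'C(2 * p j, k)%:R * a j ^+ (2 * p j - k) * b ^+ k.
transitivity (\int[P]_w
    (\prod_j (\poly_(k < (2 * p j).+1) E j k).[W j w])).
  apply: eq_Rintegral => w _; apply: eq_bigr => j _.
  rewrite horner_poly exprDn; apply: eq_bigr => k _.
  by rewrite /E -mulr_natl exprMn; ring.
rewrite Rintegral_prod_horner; apply: eq_bigr => j _; rewrite gauss_mean_poly.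
rewrite (sum_odd_vanish (f := fun k => E j k * gauss_moment 1 k)); last first.
  by move=> k odd_k; rewrite gauss_moment_odd// mulr0.
apply: eq_bigr => s _; rewrite gauss_moment_even expr1n mulr1 /E natrM -exprM.
by ring.
Qed.

End MixedMoments.

(** * Paley-Wiener-Zygmund integrals of Brownian motion *)

Section MeasurableLimit.
Context d (T : measurableType d) (R : realType).

Lemma cvgn_limn_esup_einf (u : R^nat) : cvgn u <->
  limn_einf (EFin \o u) \is a fin_num /\
  limn_esup (EFin \o u) = limn_einf (EFin \o u).
Proof.
split=> [cu|[fin_inf sup_inf]].
  have cEu : (EFin \o u) n @[n --> \oo] --> (limn u)%:E.
    by apply: cvg_EFin => //; exact: nearW.
  by have [-> ->] := cvg_limn_einf_sup cEu.
have cEu : (EFin \o u) n @[n --> \oo] --> (fine (limn_einf (EFin \o u)))%:E.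
  rewrite fineK//.
  apply: (@squeeze_cvge _ _ _ _ (einfs (EFin \o u)) _ (esups (EFin \o u))).
  - apply: nearW => n; apply/andP; split.
      by apply: ereal_inf_lbound; exists n => /=.
    by apply: ereal_sup_ubound; exists n => /=.
  - by rewrite limn_einf_lim; exact: is_cvg_einfs.
  - by rewrite -sup_inf limn_esup_lim; exact: is_cvg_esups.
by apply/cvg_ex; exists (fine (limn_einf (EFin \o u))); exact: (fine_cvg cEu).
Qed.

Variable u : nat -> T -> R.
Hypothesis measurable_u : forall n, measurable_fun setT (u n).

Lemma measurable_cvgn_set : measurable [set w | cvgn (u ^~ w)].
Proof.
have mEu n : measurable_fun setT (EFin \o u n) by exact/measurable_EFinP.
have msup := measurable_fun_limn_esup mEu.
have minf := measurable_fun_limn_einf mEu.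
rewrite (_ : [set w | _] =
    (setT `&` [set w | limn_einf (EFin \o u ^~ w) \is a fin_num]) `&`
    (setT `&` [set w | limn_esup (EFin \o u ^~ w) =
                       limn_einf (EFin \o u ^~ w)])).
  by apply: measurableI; [exact: emeasurable_fin_num|exact: measurable_eqe].
apply/seteqP; split => w /=; first by move=> /cvgn_limn_esup_einf[].
by move=> [[_ fin_inf] [_ sup_inf]]; apply/cvgn_limn_esup_einf.
Qed.

Lemma measurable_limn_or0 :
  measurable_fun setT
    (fun w => if pselect (cvgn (u ^~ w)) then limn (u ^~ w) else 0).
Proof.
pose A := [set w | cvgn (u ^~ w)].
apply: (@measurable_fun_cvg _ _ _ _ (fun n w => u n w * \1_A w)) => [n|w _].
  apply: measurable_funM => //; apply: measurable_indic.
  exact: measurable_cvgn_set.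
rewrite indicE; case: pselect => [cu|ncu]/=.
  by rewrite mem_set//; under eq_fun do rewrite mulr1.
by rewrite memNset//; under eq_fun do rewrite mulr0; exact: cvg_cst.
Qed.

End MeasurableLimit.

Lemma cvg_lincomb {R : realType} (I : Type) (s : seq I) (b : I -> R)
    (f : I -> nat -> R) (l : I -> R) :
  (forall i, f i n @[n --> \oo] --> l i) ->
  \sum_(i <- s) b i * f i n @[n --> \oo] --> \sum_(i <- s) b i * l i.
Proof.
move=> fl; elim: s => [|i s IH].
  by rewrite big_nil; under eq_fun do rewrite big_nil; exact: cvg_cst.
rewrite big_cons; under eq_fun do rewrite big_cons.
by apply: cvgD => //; apply: cvgM; [exact: cvg_cst|exact: fl].
Qed.

Section PathwiseIntegral.
Context {R : realType} (T : R).
Hypothesis T0 : 0 < T.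
Implicit Types (v x y : R -> R) (c : R).

Lemma RS_int_cvg k x : continuous x ->
  RS_sum T (cons_basis T k) x N @[N --> \oo] --> RS_int T (cons_basis T k) x.
Proof.
move=> cx; have [g dg cg] := @cons_basis_C1 _ T k.
by apply: (cvgP _ (RS_sum_cvg T0 dg cg cx)).
Qed.

Lemma RS_int_linearr k x y c : continuous x -> continuous y ->
  RS_int T (cons_basis T k) (fun t => y t + c * x t) =
  RS_int T (cons_basis T k) y + c * RS_int T (cons_basis T k) x.
Proof.
move=> cx cy; apply: cvg_lim => //.
rewrite (_ : RS_sum T _ _ = fun N => RS_sum T (cons_basis T k) y N +
    c * RS_sum T (cons_basis T k) x N); last first.
  by apply/funext => N; exact: RS_sum_linearr.
by apply: cvgD; [|apply: cvgM; first exact: cvg_cst]; exact: RS_int_cvg.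
Qed.

Lemma PWZ_partial_linearr v x y c N : continuous x -> continuous y ->
  PWZ_partial T v (fun t => y t + c * x t) N =
  PWZ_partial T v y N + c * PWZ_partial T v x N.
Proof.
move=> cx cy; rewrite /PWZ_partial mulr_sumr -big_split/=.
by apply: eq_bigr => k _; rewrite RS_int_linearr//; ring.
Qed.

Lemma PWZ_cvg v x : cvgn (PWZ_partial T v x) ->
  PWZ_partial T v x N @[N --> \oo] --> PWZ T v x.
Proof. by rewrite /PWZ; case: pselect. Qed.

Lemma PWZ_partial_cvg_linearr v x y c : continuous x -> continuous y ->
  cvgn (PWZ_partial T v x) -> cvgn (PWZ_partial T v y) ->
  PWZ_partial T v (fun t => y t + c * x t) N @[N --> \oo] -->
  PWZ T v y + c * PWZ T v x.
Proof.
move=> cx cy /PWZ_cvg cvx /PWZ_cvg cvy.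
rewrite (_ : PWZ_partial T v _ = fun N =>
  PWZ_partial T v y N + c * PWZ_partial T v x N).
  by apply: cvgD => //; apply: cvgM => //; exact: cvg_cst.
by apply/funext => N; rewrite PWZ_partial_linearr.
Qed.

Lemma PWZ_linearr v x y c : continuous x -> continuous y ->
  cvgn (PWZ_partial T v x) -> cvgn (PWZ_partial T v y) ->
  PWZ T v (fun t => y t + c * x t) = PWZ T v y + c * PWZ T v x.
Proof.
move=> cx cy cvx cvy.
have cvxy := PWZ_partial_cvg_linearr (c := c) cx cy cvx cvy.
by rewrite -(cvg_lim _ cvxy)// (cvg_lim _ (PWZ_cvg (cvgP _ cvxy))).
Qed.

Lemma is_cvg_PWZ_partialZ v x c : continuous x ->
  cvgn (PWZ_partial T v x) -> cvgn (PWZ_partial T v (fun t => c * x t)).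
Proof.
move=> cx cvx; have := PWZ_partial_cvg_linearr (c := c - 1) cx cx cvx cvx.
rewrite (_ : (fun t => x t + _) = fun t => c * x t); first exact: cvgP.
by apply/funext => t; ring.
Qed.

Lemma measurable_RS_sum d (Om : measurableType d) (Y : Om -> R -> R) phi N :
  (forall t, measurable_fun setT (Y ^~ t)) ->
  measurable_fun setT (fun w => RS_sum T phi (Y w) N).
Proof.
move=> mY; apply: measurable_sum => i; apply: measurable_funM => //.
exact: measurable_funB.
Qed.

Lemma measurable_PWZ d (Om : measurableType d) (Y : Om -> R -> R) v :
  (forall w, continuous (Y w)) -> (forall t, measurable_fun setT (Y ^~ t)) ->
  measurable_fun setT (fun w => PWZ T v (Y w)).
Proof.
move=> cY mY; apply:
  (measurable_limn_or0 (u := fun N w => PWZ_partial T v (Y w) N)) => N.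
apply: measurable_sum => k; apply: measurable_funM => //.
apply: (@measurable_fun_cvg _ _ _ _
  (fun M w => RS_sum T (cons_basis T k) (Y w) M)).
  by move=> M; exact: measurable_RS_sum.
by move=> w _; exact: RS_int_cvg.
Qed.

End PathwiseIntegral.

Section WienerIntegrals.
Context {R : realType} (T : R).
Hypothesis T0 : 0 < T.
Context d (Omega : measurableType d) (P : probability Omega R).
Variable X : Omega -> R -> R.
Hypothesis wienerX : is_wiener T P X.

Let continuousX w : continuous (X w).
Proof. by have [/(_ w)[]] := wienerX. Qed.

Let measurableX t : measurable_fun setT (X ^~ t).
Proof. by have [] := wienerX. Qed.

Lemma RS_sum_gaussian phi N : gaussian_moments P
  (\sum_(i < N) phi (node T N i) ^+ 2 * (T / N%:R))
  (fun w => RS_sum T phi (X w) N).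
Proof.
have [_ _ law] := wienerX.
have step_gt0 i : (i < N)%N -> 0 < T / N%:R.
  by move=> iN; rewrite divr_gt0// ltr0n; exact: leq_ltn_trans iN.
have := gaussian_moments_sum (P := P) (N := N)
  (xi := fun i w => X w (node T N i.+1) - X w (node T N i))
  (s := fun i => Num.sqrt (node T N i.+1 - node T N i))
    _ _ _ (fun i => phi (node T N i)).
under eq_bigr => i _ do
  rewrite nodeS sqr_sqrtr ?(ltW (step_gt0 _ (ltn_ord i)))//.
apply.
- by move=> i; exact: measurable_funB.
- by move=> i iN; rewrite nodeS sqrtr_gt0 (step_gt0 i).
- move=> B mB; apply: law => //; first exact: node0.
    by move=> i iN; rewrite -subr_gt0 nodeS (step_gt0 i).
  by have /andP[] := node_segment T0 (leqnn N).
Qed.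

Definition cos_coord k w := RS_int T (cons_basis T k) (X w).

Lemma cos_coord_gaussian N (b : nat -> R) : gaussian_moments P
  (\sum_(k < N) b k ^+ 2) (fun w => \sum_(k < N) b k * cos_coord k w).
Proof.
pose S M w := RS_sum T (cos_poly T N b) (X w) M.
have cvS w : S M w @[M --> \oo] --> \sum_(k < N) b k * cos_coord k w.
  rewrite (_ : S ^~ w = fun M =>
    \sum_(k < N) b k * RS_sum T (cons_basis T k) (X w) M).
    by apply: cvg_lincomb => k; exact: RS_int_cvg.
  by apply/funext => M; exact: RS_sum_suml.
apply: gaussian_moments_limit.
- by move=> M; exact: (RS_sum_gaussian (cos_poly T N b) M).
- exact: riemann_sum_cos_poly.
- apply: (@measurable_fun_cvg _ _ _ _ S) => [M|w _]; last exact: cvS.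
  exact: measurable_RS_sum.
- by apply: aeW; exact: cvS.
Qed.

Lemma ae_cvg_PWZ_partial v : inL2 T v ->
  {ae P, forall w, cvgn (PWZ_partial T v (X w))}.
Proof.
move=> /(parseval T0)/cvgP.
exact: (ae_cvg_gaussian_series cos_coord_gaussian
  (c := fun k => L2ip T v (cons_basis T k))).
Qed.

Variables (n : nat) (alpha : 'I_n -> R -> R).
Hypothesis alpha_orthonormal : L2orthonormal T alpha.

Let Lalpha j : inL2 T (alpha j). Proof. by have [] := alpha_orthonormal. Qed.

Lemma ae_cvg_PWZ_partial_family :
  {ae P, forall w, forall j, cvgn (PWZ_partial T (alpha j) (X w))}.
Proof. by apply: filter_forall => j; exact: ae_cvg_PWZ_partial. Qed.

Lemma PWZ_family_gaussian (t : 'I_n -> R) : gaussian_moments P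
  (\sum_j t j ^+ 2) (fun w => \sum_j t j * PWZ T (alpha j) (X w)).
Proof.
pose u s := \sum_j t j * alpha j s.
have Lu : inL2 T u by apply: inL2_sum => // j; exact: inL2Z.
have partialE w N : \sum_(k < N) L2ip T u (cons_basis T k) * cos_coord k w =
    \sum_j t j * PWZ_partial T (alpha j) (X w) N.
  rewrite /PWZ_partial; under [RHS]eq_bigr do rewrite mulr_sumr.
  rewrite exchange_big/=; apply: eq_bigr => k _.
  rewrite L2ip_suml//; last exact/(inL2_continuous T0)/continuous_cons_basis.
  by rewrite mulr_suml; apply: eq_bigr => j _; rewrite mulrA.
apply: gaussian_moments_limit.
- move=> N; exact: (cos_coord_gaussian N (fun k => L2ip T u (cons_basis T k))).
- by rewrite -(L2ip_orthonormal_comb T0 t alpha_orthonormal); exact: parseval.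
- apply: measurable_sum => j; apply: measurable_funM => //.
  exact: measurable_PWZ.
- apply: filterS ae_cvg_PWZ_partial_family => w cvX.
  by under eq_fun do rewrite partialE; apply: cvg_lincomb => j; exact: PWZ_cvg.
Qed.

Lemma all_moments_PWZ j : all_moments P (fun w => PWZ T (alpha j) (X w)).
Proof.
have [+ _] := PWZ_family_gaussian (fun i => (i == j)%:R).
congr (all_moments P _); apply/funext => w.
rewrite (bigD1 j)//= eqxx mul1r big1 ?addr0// => i ij.
by rewrite (negbTE ij) mul0r.
Qed.

Variables (p : 'I_n -> nat) (y : R -> R) (b : R).
Hypothesis continuous_y : continuous y.
Hypothesis cvg_y : forall j, cvgn (PWZ_partial T (alpha j) y).

Let shifted w :=
  \prod_j PWZ T (alpha j) (fun t => y t + b * X w t) ^+ (2 * p j).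
Let expanded w :=
  \prod_j (PWZ T (alpha j) y + b * PWZ T (alpha j) (X w)) ^+ (2 * p j).

Let measurable_shifted : measurable_fun setT shifted.
Proof.
apply: measurable_prod => j _; apply: measurable_funX.
apply: (measurable_PWZ T0 (Y := fun w t => y t + b * X w t)) => [w t|t].
  apply: cvgD; first exact: continuous_y.
  by apply: cvgM; [exact: cvg_cst|exact: continuousX].
by apply: measurable_funD => //; exact: measurable_funM.
Qed.

Let all_moments_expanded : all_moments P expanded.
Proof.
apply: (@all_moments_prod _ _ _ P _ _ _
  (fun j w => (PWZ T (alpha j) y + b * PWZ T (alpha j) (X w)) ^+ (2 * p j)))
  => j.
apply/all_momentsX/all_momentsD; first exact: all_moments_cst.
exact/all_momentsZ/all_moments_PWZ.
Qed.

Let ae_shifted : {ae P, forall w, setT w -> expanded w = shifted w}.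
Proof.
apply: filterS ae_cvg_PWZ_partial_family => w cvX _.
by apply: eq_bigr => j _; rewrite PWZ_linearr.
Qed.

Lemma integrable_PWZ_shift : P.-integrable setT (EFin \o shifted).
Proof.
apply: (ae_eq_integrable measurableT measurable_shifted ae_shifted).
exact: all_moments_int.
Qed.

Lemma Rintegral_PWZ_shift : \int[P]_w shifted w =
  \prod_j \sum_(s < (p j).+1) ('C(2 * p j, 2 * s) * odd_dfact s)%:R *
    (b ^+ 2) ^+ s * PWZ T (alpha j) y ^+ (2 * p j - 2 * s).
Proof.
rewrite -(Rintegral_prod_even_powers all_moments_PWZ PWZ_family_gaussian).
apply/esym/(ae_eq_Rintegral measurableT _ measurable_shifted ae_shifted).
exact: measurable_all_moments all_moments_expanded.
Qed.

End WienerIntegrals.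

(** * Analytic continuation *)

Lemma derivable_horner_inv (K : numFieldType) (Q : {poly K}) (z : K) :
  z != 0 -> derivable (fun w : K => Q.[w^-1]) z 1.
Proof.
move=> z0; elim/poly_ind: Q => [|Q c IH].
  by under eq_fun do rewrite horner0; exact: derivable_cst.
under eq_fun do rewrite hornerMXaddC.
apply: derivableD; last exact: derivable_cst.
by apply: derivableM => //; apply: derivableV => //; exact: derivable_id.
Qed.

Lemma continuous_horner_inv (K : numFieldType) (Q : {poly K}) (z : K) :
  z != 0 -> Q.[w^-1] @[w --> z] --> Q.[z^-1].
Proof.
move=> /(derivable_horner_inv (Q := Q))/derivable1_diffP.
exact: differentiable_continuous.
Qed.

Section PolynomialContinuation.
Context {R : realType}.
Local Notation C := (@Cx R).

Lemma analytic_horner_inv (Q : {poly C}) :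
  analytic_on_Cplus (fun z : C => Q.[z^-1]).
Proof.
move=> z z0; have zN0 : z != 0.
  by apply/eqP => ze; move: z0; rewrite /Cplus/= ze ltxx.
have /cvg_ex[D QD] := derivable_horner_inv (Q := Q) zN0; exists D.
rewrite (_ : (fun h => _) = fun h : C =>
    h^-1 *: (((fun w : C => Q.[w^-1]) \o shift z) (h *: 1) - Q.[z^-1])) //.
by apply/funext => h; rewrite mulrC /= [h *: 1]mulr1 [h + z]addrC.
Qed.

Lemma RtoC_neq0 (x : R) : (RtoC x != 0 :> C) = (x != 0).
Proof. by rewrite -[RtoC]/(real_complex R) fmorph_eq0. Qed.

Lemma iC_sqr : iC * iC = -1 :> C.
Proof. by rewrite -expr2; exact: sqr_i. Qed.

Lemma iC_neq0 : iC != 0 :> C.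
Proof. by rewrite -sqrf_eq0 expr2 iC_sqr oppr_eq0 oner_eq0. Qed.

Lemma inv_minus_iq (q : R) : (- iC * RtoC q)^-1 = iC / RtoC q :> C.
Proof.
rewrite invfM invrN; congr (_ / _).
by apply: (mulfI iC_neq0); rewrite mulrN divff ?iC_neq0// iC_sqr.
Qed.

Context d (Omega : measurableType d) (P : probability Omega R).
Variable X : Omega -> R -> R.

Lemma wint_RtoC (f : (R -> R) -> R) :
  wint P X (fun x => RtoC (f x)) = RtoC (\int[P]_w f (X w)).
Proof.
by rewrite /wint /= Rintegral_cst// mul0r [RtoC 0](_ : _ = 0)// mulr0 addr0.
Qed.

Lemma FFT1_at_polynomial (f : (R -> R) -> R) (q : R) (y : R -> R)
    (Q : {poly C}) :
  q != 0 ->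
  (forall lam, 0 < lam -> P.-integrable setT
     (EFin \o (fun w => f (fun t => y t + scale_path lam (X w) t)))) ->
  (forall lam, 0 < lam -> Q.[(RtoC lam)^-1] =
     RtoC (\int[P]_w f (fun t => y t + scale_path lam (X w) t))) ->
  FFT1_at P X (fun x => RtoC (f x)) q y Q.[iC / RtoC q].
Proof.
move=> q0 f_int QE; split=> [lam lam0|].
  by split; [exact: f_int|exact: (finite_measure_integrable_cst _ 0)].
exists (fun z => Q.[z^-1]); split; first exact: analytic_horner_inv.
  by move=> lam lam0; rewrite QE// (wint_RtoC (fun x => f _)).
rewrite -inv_minus_iq; apply: cvg_within_filter.
have iq0 : - iC * RtoC q != 0.
  by rewrite mulf_neq0 ?oppr_eq0 ?iC_neq0 ?RtoC_neq0.
exact: (continuous_horner_inv (Q := Q) iq0).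
Qed.

End PolynomialContinuation.

Section TransformPolynomial.
Context {R : realType} (n : nat) (a : 'I_n -> R) (p : 'I_n -> nat).
Local Notation C := (@Cx R).

Definition fft_poly : {poly C} := \prod_(j < n) \sum_(s < (p j).+1)
  (('C(2 * p j, 2 * s) * odd_dfact s)%:R * RtoC (a j) ^+ (2 * p j - 2 * s))
    *: 'X^s.

Lemma horner_fft_poly (z : C) : fft_poly.[z] =
  \prod_(j < n) \sum_(s < (p j).+1)
    ('C(2 * p j, 2 * s) * odd_dfact s)%:R * z ^+ s *
    RtoC (a j) ^+ (2 * p j - 2 * s).
Proof.
rewrite horner_prod; apply: eq_bigr => j _; rewrite horner_sum.
by apply: eq_bigr => s _; rewrite hornerZ hornerXn mulrAC.
Qed.

Lemma horner_fft_poly_real (x : R) : fft_poly.[RtoC x] =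
  RtoC (\prod_(j < n) \sum_(s < (p j).+1)
    ('C(2 * p j, 2 * s) * odd_dfact s)%:R * x ^+ s * a j ^+ (2 * p j - 2 * s)).
Proof.
rewrite horner_fft_poly -[RtoC]/(real_complex R) rmorph_prod/=.
apply: eq_bigr => j _; rewrite rmorph_sum/=; apply: eq_bigr => s _.
by rewrite !rmorphM/= !rmorph_nat !rmorphXn.
Qed.

End TransformPolynomial.

Section FourierFeynman.
Context {R : realType} (T : R).
Hypothesis T0 : 0 < T.
Context d (Omega : measurableType d) (P : probability Omega R).
Variable X : Omega -> R -> R.
Hypothesis wienerX : is_wiener T P X.
Variables (n : nat) (alpha : 'I_n -> R -> R).
Hypothesis alpha_orthonormal : L2orthonormal T alpha.

Lemma si_null_PWZ_divergence : si_null P X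
  [set y | C0 T y /\ ~ forall j, cvgn (PWZ_partial T (alpha j) y)].
Proof.
move=> rho rho0.
have [A [mA PA0 subA]] :=
  ae_cvg_PWZ_partial_family T0 wienerX alpha_orthonormal.
exists A; split=> //; split=> // w [y [[cy _] ncv_y] yX]; apply: subA => /= cvX.
apply: ncv_y => j; have -> : y = fun t => rho^-1 * X w t.
  by apply/funext => t; rewrite -yX mulKf// gt_eqF.
by apply: is_cvg_PWZ_partialZ => //; have [/(_ w)[]] := wienerX.
Qed.

Lemma FFT1_at_PWZ_powers (p : 'I_n -> nat) (q : R) (y : R -> R) : q != 0 ->
  continuous y -> (forall j, cvgn (PWZ_partial T (alpha j) y)) ->
  FFT1_at P X (fun x => RtoC (\prod_(j < n) PWZ T (alpha j) x ^+ (2 * p j))) q y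
    (fft_poly (fun j => PWZ T (alpha j) y) p).[iC / RtoC q].
Proof.
move=> q0 cy cvy; apply: FFT1_at_polynomial => // lam lam0.
  exact: (integrable_PWZ_shift T0 wienerX alpha_orthonormal).
rewrite (Rintegral_PWZ_shift T0 wienerX alpha_orthonormal)//.
rewrite exprVn sqr_sqrtr ?(ltW lam0)// -horner_fft_poly_real.
by rewrite -[RtoC]/(real_complex R) fmorphV.
Qed.

End FourierFeynman.

Theorem theorem2 (R : realType) (T : R) (hT : 0 < T)
    (d : measure_display) (Omega : measurableType d)
    (P : probability Omega R) (X : Omega -> R -> R) (hX : is_wiener T P X)
    (n : nat) (alpha : 'I_n -> R -> R) (halpha : L2orthonormal T alpha)
    (p : 'I_n -> nat) (q : R) (hq : q != 0) :
  FFT1_sae P X T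
    (fun x => RtoC (\prod_(j < n) PWZ T (alpha j) x ^+ (2 * p j)))
    q
    (fun y => \prod_(j < n) \sum_(s < (p j).+1)
        (('C(2 * p j, 2 * s) * odd_dfact s)%:R : Cx)
        * (iC / RtoC q) ^+ s
        * RtoC (PWZ T (alpha j) y) ^+ (2 * p j - 2 * s)).
Proof.
exists [set y | C0 T y /\ ~ forall j, cvgn (PWZ_partial T (alpha j) y)].
split=> [|y C0y convergent]; first exact: si_null_PWZ_divergence.
have cvy j : cvgn (PWZ_partial T (alpha j) y).
  by apply: contrapT => ncv; apply: convergent; split => // /(_ j).
rewrite -(horner_fft_poly (fun j => PWZ T (alpha j) y)).
by apply: FFT1_at_PWZ_powers => //; case: C0y.
Qed.
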